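(* Let $(\mathcal{M}_1,\tau_1)$ and $(\mathcal{M}_2,\tau_2)$ be finite von Neumann algebras, let $\mathcal{M}=(\mathcal{M}_1,\tau_1)*(\mathcal{M}_2,\tau_2)$ be the reduced free product von Neumann algebra, and let $\tau$ be the induced faithful normal trace on $\mathcal{M}$. Suppose $\mathcal{N}\subseteq\mathcal{M}_1$ is a diffuse von Neumann subalgebra and $Z\in\mathcal{M}_2$ is not a scalar. In $\mathcal{B}(L^2(\mathcal{M},\tau))$, let $\mathfrak{A}$ be the algebra generated by $Z$, $\mathcal{N}$ and $\mathcal{M}'$. Then $\mathfrak{A}$ is a transitive algebra and is strongly dense in $\mathcal{B}(L^2(\mathcal{M},\tau))$.
   Context: $\tau_1,\tau_2$ are faithful normal (normalized) traces. $\mathcal{M}_1,\mathcal{M}_2$ are viewed as subalgebras of $\mathcal{M}$. $\mathcal{M}$ acts on $L^2(\mathcal{M},\tau)$ by left multiplication and $\mathcal{M}'$ is its commutant in $\mathcal{B}(L^2(\mathcal{M},\tau))$. A von Neumann algebra is diffuse if it has no minimal projections. ''Algebra generated'' means the (not necessarily self-adjoint or closed) algebra generated. A subalgebra of $\mathcal{B}(\mathcal{H})$ is transitive if it contains the identity and has no invariant closed subspaces other than $\{0\}$ and $\mathcal{H}$. ''Strongly dense'' means dense in the strong operator topology. *)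

(* Defs.v *)
From HB Require Import structures.
From mathcomp Require Import all_boot all_order all_algebra.
From mathcomp Require Import complex.
From mathcomp Require Import all_classical all_reals all_analysis.

Set Implicit Arguments.
Unset Strict Implicit.
Unset Printing Implicit Defensive.

Import Order.TTheory GRing.Theory Num.Theory.
Import numFieldNormedType.Exports.

Local Open Scope classical_set_scope.
Local Open Scope complex_scope.
Local Open Scope ring_scope.

(* A complex Hilbert space: a complete normed space over R[i] whose norm comes
   from an inner product (linear on the left, conjugate-linear on the right). *)
HB.mixin Record CompleteNormedModule_isHilbert (R : realType) H
    of CompleteNormedModule R[i] H := {
  dotform : {dot H for (@Num.conj R[i])};
  dotform_norm : forall x : H, dotform x x = `|x| ^+ 2 }.

#[short(type="hilbertType")]
HB.structure Definition Hilbert (R : realType) :=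
  { H of CompleteNormedModule_isHilbert R H & CompleteNormedModule R[i] H }.

Definition dot (R : realType) (H : hilbertType R) (x y : H) : R[i] :=
  (dotform : {dot H for (@Num.conj R[i])}) x y.

Section Operators.
Variables (R : realType) (H : hilbertType R).
Implicit Types (S T P Q : H -> H) (A M : set (H -> H)) (W : set H).

(* B(H) *)
Definition bounded_op : set (H -> H) := [set T | linear T /\ continuous T].

Definition adjoint S T := forall x y, dot (S x) y = dot x (T y).

Definition op_le S T := forall x, dot (S x) x <= dot (T x) x.

Definition commutant A : set (H -> H) :=
  [set T | bounded_op T /\ forall S, A S -> T \o S = S \o T].

(* A von Neumann algebra on H is a self-adjoint set of bounded operators equal
   to its bicommutant; it contains the identity of H. *)
Definition von_neumann M :=
  (forall T, M T -> exists2 T', M T' & adjoint T T') /\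
  commutant (commutant M) = M.

Definition selfadjoint_part M : set (H -> H) := [set T | M T /\ adjoint T T].

Definition projection P := [/\ bounded_op P, adjoint P P & P \o P = P].

Definition minimal_projection M P :=
  [/\ M P, projection P, P <> 0 &
      forall Q, M Q -> projection Q -> op_le Q P -> Q = 0 \/ Q = P].

Definition diffuse M := ~ exists P, minimal_projection M P.

(* D is an upward directed set with least upper bound T in the self-adjoint
   part of M. *)
Definition increasing_to M (D : set (H -> H)) T :=
  [/\ D `<=` selfadjoint_part M,
      D !=set0,
      (forall S1 S2, D S1 -> D S2 ->
         exists S, [/\ D S, op_le S1 S & op_le S2 S]),
      selfadjoint_part M T /\ (forall S, D S -> op_le S T) &
      forall T', selfadjoint_part M T' -> (forall S, D S -> op_le S T') ->
        op_le T T'].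

(* Only the values of tau on M are relevant.  Traces of self-adjoint elements
   are real, so tr_normal says that tau T is the supremum of tau on D. *)
Record faithful_normal_trace M (tau : (H -> H) -> R[i]) : Prop := {
  tr_linear : forall (a : R[i]) S T, M S -> M T ->
    tau (a *: S + T) = a * tau S + tau T ;
  tr_one : tau id = 1 ;
  tr_comm : forall S T, M S -> M T -> tau (S \o T) = tau (T \o S) ;
  tr_ge0 : forall S S', M S -> adjoint S S' -> 0 <= tau (S' \o S) ;
  tr_faithful : forall S S', M S -> adjoint S S' -> tau (S' \o S) = 0 ->
    S = 0 ;
  tr_normal : forall (D : set (H -> H)) T, increasing_to M D T ->
    forall c : R[i], (forall S, D S -> tau S <= c) -> tau T <= c }.

(* Not necessarily unital, self-adjoint or closed. *)
Definition subalgebra A :=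
  [/\ A `<=` bounded_op, A 0,
      (forall (a : R[i]) S T, A S -> A T -> A (a *: S + T)) &
      forall S T, A S -> A T -> A (S \o T)].

Definition closed_subspace W :=
  [/\ closed W, W 0 & forall (a : R[i]) x y, W x -> W y -> W (a *: x + y)].

Definition invariant A W := forall T, A T -> T @` W `<=` W.

Definition transitive_algebra A :=
  [/\ subalgebra A, A id &
      forall W, closed_subspace W -> invariant A W ->
        W = [set 0] \/ W = setT].

(* The strong operator topology on B(H) is the topology of pointwise
   convergence in norm. *)
Definition strongly_dense A :=
  A `<=` bounded_op /\ bounded_op `<=` closure (A : set {ptws H -> H}).

End Operators.

(* L^2(M, tau): the Hilbert space completion of M for the inner product
   (S, T) |-> tau (T^* S), with the left multiplication action of M.  It is
   unique up to a unitary intertwining these data. *)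
Record L2 (R : realType) (K : hilbertType R) (M : set (K -> K))
    (tau : (K -> K) -> R[i]) := {
  L2_space :> hilbertType R ;
  L2_vec : (K -> K) -> L2_space ;
  L2_mul : (K -> K) -> (L2_space -> L2_space) ;
  L2_vec_linear : forall (a : R[i]) S T, M S -> M T ->
    L2_vec (a *: S + T) = a *: L2_vec S + L2_vec T ;
  L2_vec_dot : forall S T T', M S -> M T -> adjoint T T' ->
    dot (L2_vec S) (L2_vec T) = tau (T' \o S) ;
  L2_vec_dense : dense (L2_vec @` M) ;
  L2_mul_bounded : forall T, M T -> bounded_op (L2_mul T) ;
  L2_mul_vec : forall S T, M S -> M T ->
    L2_mul T (L2_vec S) = L2_vec (T \o S) }.

Arguments L2_vec {R K M tau} _ _.
Arguments L2_mul {R K M tau} _ _.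

Section Words.
Variables (R : realType) (E1 E2 : hilbertType R) (xi1 : E1) (xi2 : E2).

Definition on_left (a : E1 + E2) := if a is inl _ then true else false.

Definition centred (a : E1 + E2) : bool :=
  match a with inl x => dot x xi1 == 0 | inr y => dot y xi2 == 0 end.

(* w = h_1 ... h_n stands for the simple tensor h_1 (x) ... (x) h_n, where
   h_k is orthogonal to xi_(i_k) in E_(i_k) and i_1 != i_2 != ... != i_n. *)
Definition reduced (w : seq (E1 + E2)) : bool :=
  all centred w && sorted (fun a b => on_left a != on_left b) w.

Definition reduced_off_left (w : seq (E1 + E2)) : bool :=
  reduced w && (if w is a :: _ then ~~ on_left a else true).

Definition reduced_off_right (w : seq (E1 + E2)) : bool :=
  reduced w && (if w is a :: _ then on_left a else true).

Definition letter_dot (a b : E1 + E2) : R[i] :=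
  match a, b with
  | inl x, inl y => dot x y
  | inr x, inr y => dot x y
  | _, _ => 0
  end.

Fixpoint word_dot (u v : seq (E1 + E2)) : R[i] :=
  match u, v with
  | [::], [::] => 1
  | a :: u', b :: v' => letter_dot a b * word_dot u' v'
  | _, _ => 0
  end.

(* The free product (H, Omega) of the pointed Hilbert spaces (E1, xi1) and
   (E2, xi2): H is the Hilbert space direct sum of C Omega and of the tensor
   products of the alternating sequences of orthocomplements of xi1 and xi2.
   fp_word gives the simple tensors (its values on non-reduced words carry no
   meaning) and fp_word [::] is Omega.

   fp_rep1 is the left action of B(E1): under the unitary
     V : E1 (x) H(off left) -> H,
     V (h (x) w) = <h, xi1> w + (h - <h, xi1> xi1) (x) w,
   it is T |-> V (T (x) 1) V^*.  Likewise for fp_rep2. *)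
Record free_product := {
  fp_space :> hilbertType R ;
  fp_word : seq (E1 + E2) -> fp_space ;
  fp_rep1 : (E1 -> E1) -> (fp_space -> fp_space) ;
  fp_rep2 : (E2 -> E2) -> (fp_space -> fp_space) ;
  fp_word_dot : forall u v, reduced u -> reduced v ->
    dot (fp_word u) (fp_word v) = word_dot u v ;
  fp_word_total : forall W : set fp_space, closed_subspace W ->
    (forall w, reduced w -> W (fp_word w)) -> W = setT ;
  fp_V1 := fun (h : E1) (w : seq (E1 + E2)) =>
    dot h xi1 *: fp_word w + fp_word (inl (h - dot h xi1 *: xi1) :: w) ;
  fp_V2 := fun (h : E2) (w : seq (E1 + E2)) =>
    dot h xi2 *: fp_word w + fp_word (inr (h - dot h xi2 *: xi2) :: w) ;
  fp_rep1_bounded : forall T, bounded_op T -> bounded_op (fp_rep1 T) ;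
  fp_rep2_bounded : forall T, bounded_op T -> bounded_op (fp_rep2 T) ;
  fp_rep1_V : forall T h w, bounded_op T -> reduced_off_left w ->
    fp_rep1 T (fp_V1 h w) = fp_V1 (T h) w ;
  fp_rep2_V : forall T h w, bounded_op T -> reduced_off_right w ->
    fp_rep2 T (fp_V2 h w) = fp_V2 (T h) w }.

End Words.

Arguments fp_word {R E1 E2 xi1 xi2} _ _.
Arguments fp_rep1 {R E1 E2 xi1 xi2} _ _ _.
Arguments fp_rep2 {R E1 E2 xi1 xi2} _ _ _.

Section FreeProductAlgebra.
Variables (R : realType) (K1 K2 : hilbertType R).
Variables (M1 : set (K1 -> K1)) (tau1 : (K1 -> K1) -> R[i]).
Variables (M2 : set (K2 -> K2)) (tau2 : (K2 -> K2) -> R[i]).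
Variables (E1 : L2 M1 tau1) (E2 : L2 M2 tau2).

Definition L2_free_product := free_product (L2_vec E1 id) (L2_vec E2 id).

Variable F : L2_free_product.

Definition emb1 (T : K1 -> K1) : F -> F := fp_rep1 F (L2_mul E1 T).
Definition emb2 (T : K2 -> K2) : F -> F := fp_rep2 F (L2_mul E2 T).

Definition reduced_free_product : set (F -> F) :=
  commutant (commutant (emb1 @` M1 `|` emb2 @` M2)).

Definition vacuum_trace (T : F -> F) : R[i] :=
  dot (T (fp_word F [::])) (fp_word F [::]).

End FreeProductAlgebra.

Arguments emb1 {R K1 K2 M1 tau1 M2 tau2 E1 E2} F T.
Arguments emb2 {R K1 K2 M1 tau1 M2 tau2 E1 E2} F T.
Arguments reduced_free_product {R K1 K2 M1 tau1 M2 tau2 E1 E2} F.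
Arguments vacuum_trace {R K1 K2 M1 tau1 M2 tau2 E1 E2} F T.

(* Main.v *)
(* Identify L^2(M, tau) with the free product space F by S |-> S Omega; besides
   the left actions of M1 and M2, F carries right actions commuting with M, and
   right multiplications belong to M'.  For the density it is enough to show that
   a closed subspace of F^n invariant under the algebra is of the form F (x) V
   with V a subspace of C^n.  The entries P_ij of its projection commute with N
   and with the right multiplications.  A diffuse algebra has partitions of unity
   into projections e of arbitrarily small trace, and p = P_ij Omega satisfies
   e p = p e for all of them; since |e y e| = O(tau e) when y is orthogonal to
   L^2(M1), p lies in L^2(M1).  Finally (1 - P) Z P = 0, tested on the words
   Z b and b Z with b in M1, shows that each P_ij Omega is a multiple of Omega,
   so P is a scalar matrix. *)
Require Import Defs.
From mathcomp Require Import all_boot all_order all_algebra.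
From mathcomp Require Import complex.
From mathcomp Require Import all_classical all_reals all_analysis.
From mathcomp Require Import ring lra.

Set Implicit Arguments.
Unset Strict Implicit.
Unset Printing Implicit Defensive.

Import Order.TTheory GRing.Theory Num.Theory.
Import numFieldNormedType.Exports.

Local Open Scope classical_set_scope.
Local Open Scope complex_scope.
Local Open Scope ring_scope.

(** The algebra contains [Z] but not visibly its adjoint, so the bicommutant theorem does not apply.
    Only operators whose adjoints are also available, the projections of N and the right
    multiplications, commute with the projection P onto an invariant subspace. [Z] gives just the
    one-sided relation P Z P = Z P, and everything beyond L^2(M1) has to be extracted from it.
    Tuples enter because a strong neighbourhood tests finitely many vectors: the closure of all (T
    x_1, ..., T x_n) is invariant and contains x. Once P is a scalar matrix, it commutes with every
    linear map applied coordinatewise. The bound on e y e comes from y = a (x) c (x) b with c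
    nonempty: [e] acts on a from the left and on b from the right, two separate legs, each of norm
    O(tau(e)^(1/2)). A vector of L^2(M1) has one leg, hence no such gain. Summing |<e p, y>| <= B |e
    p| tau(e) over a partition with traces at most eps, Cauchy-Schwarz gives |<p, y>| <= B |p|
    eps^(1/2). *)

Local Notation "z ^*" := (Num.conj z).

(** * Hilbert spaces *)

Section Hilbert.
Variables (R : realType) (H : hilbertType R).
Implicit Types (x y z : H) (a b : R[i]).

Lemma dotDl x y z : dot (x + y) z = dot x z + dot y z.
Proof. by move=> *; exact: linearDl. Qed.
Lemma dotZl a x y : dot (a *: x) y = a * dot x y.
Proof. exact: linearZl_LR. Qed.
Lemma dotDr x y z : dot x (y + z) = dot x y + dot x z.
Proof. exact: linearDr. Qed.
Lemma dotZr a x y : dot x (a *: y) = a^* * dot x y.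
Proof. exact: linearZr_LR. Qed.
Lemma dotC x y : dot x y = (dot y x)^*.
Proof. by have := hermC (dotform : {dot H for _}) x y; rewrite expr0 mul1r. Qed.
Lemma dot_norm x : dot x x = `|x| ^+ 2.
Proof. exact: dotform_norm. Qed.

Local Notation Re := (@complex.Re R).

(* The norm of a complex normed space is valued in the partially ordered R[i];
   [nr] is the same number in R. *)
Definition nr (V : normedZmodType R[i]) (x : V) : R := Re `|x|.

Lemma normE (V : normedZmodType R[i]) (x : V) : `|x| = (nr x)%:C.
Proof. by rewrite /nr RRe_real ?normr_real. Qed.

Lemma nr_ge0 (V : normedZmodType R[i]) (x : V) : 0 <= nr x.
Proof. by rewrite -ler0c -normE. Qed.

Lemma nr0 (V : normedZmodType R[i]) : nr (0 : V) = 0.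
Proof. by rewrite /nr normr0. Qed.

Lemma nr_eq0 (V : normedZmodType R[i]) (x : V) : nr x = 0 -> x = 0.
Proof. by move=> x0; apply: normr0_eq0; rewrite normE x0 rmorph0. Qed.

Lemma nrD (V : normedZmodType R[i]) (x y : V) : nr (x + y) <= nr x + nr y.
Proof. by rewrite -lecR rmorphD/= -!normE ler_normD. Qed.

Lemma nrN (V : normedZmodType R[i]) (x : V) : nr (- x) = nr x.
Proof. by rewrite /nr normrN. Qed.

Lemma nrB (V : normedZmodType R[i]) (x y : V) : nr (x - y) = nr (y - x).
Proof. by rewrite /nr distrC. Qed.

Lemma nrZ (V : normedModType R[i]) a (x : V) : nr (a *: x) = nr a * nr x.
Proof. by apply: complexI; rewrite rmorphM/= -!normE normrZ. Qed.

Lemma nrM a b : nr (a * b) = nr a * nr b.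
Proof. by apply: complexI; rewrite rmorphM/= -!normE normrM. Qed.

Lemma nr_conj a : nr a^* = nr a.
Proof. by rewrite /nr norm_conjC. Qed.

Lemma nr_real (r : R) : nr r%:C = `|r|.
Proof. by rewrite /nr normc_def/= expr0n addr0 sqrtr_sqr. Qed.

Lemma mul_conj a : a * a^* = (nr a ^+ 2)%:C.
Proof. by rewrite -normCK normE rmorphXn. Qed.

Lemma Re_nr a : Re a <= nr a.
Proof. by rewrite -lecR -normE (le_trans _ (normc_ge_Re a))// lecR ler_norm. Qed.

Lemma dotx x : dot x x = (nr x ^+ 2)%:C.
Proof. by rewrite dot_norm normE rmorphXn. Qed.

Lemma dotNl x y : dot (- x) y = - dot x y.
Proof. by rewrite -scaleN1r dotZl mulN1r. Qed.
Lemma dotNr x y : dot x (- y) = - dot x y.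
Proof. by rewrite -scaleN1r dotZr rmorphN1 mulN1r. Qed.
Lemma dotBl x y z : dot (x - y) z = dot x z - dot y z.
Proof. by rewrite dotDl dotNl. Qed.
Lemma dotBr x y z : dot x (y - z) = dot x y - dot x z.
Proof. by rewrite dotDr dotNr. Qed.
Lemma dot0l y : dot (0 : H) y = 0.
Proof. by rewrite -(scale0r (0 : H)) dotZl mul0r. Qed.
Lemma dot0r x : dot x (0 : H) = 0.
Proof. by rewrite dotC dot0l rmorph0. Qed.
Lemma dot_suml I (s : seq I) (f : I -> H) y :
  dot (\sum_(i <- s) f i) y = \sum_(i <- s) dot (f i) y.
Proof. by elim/big_rec2: _ => [|i u v _ <-]; rewrite ?dot0l ?dotDl. Qed.
Lemma dot_sumr I (s : seq I) (f : I -> H) x :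
  dot x (\sum_(i <- s) f i) = \sum_(i <- s) dot x (f i).
Proof. by elim/big_rec2: _ => [|i u v _ <-]; rewrite ?dot0r ?dotDr. Qed.

Lemma dot_eq0 x : dot x x = 0 -> x = 0.
Proof. by rewrite dotx => -[/eqP]; rewrite sqrf_eq0 => /eqP /nr_eq0. Qed.

Lemma nr_sqr x : nr x ^+ 2 = Re (dot x x).
Proof. by rewrite dotx. Qed.

Lemma Re_dotC x y : Re (dot x y) = Re (dot y x).
Proof. by rewrite dotC; case: (dot y x). Qed.

Lemma nrD_sqr x y : nr (x + y) ^+ 2 = nr x ^+ 2 + nr y ^+ 2 + 2 * Re (dot x y).
Proof.
by rewrite !nr_sqr dotDl !dotDr !raddfD/= (Re_dotC y x); ring.
Qed.

Lemma cauchy_schwarz x y : nr (dot x y) <= nr x * nr y.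
Proof.
have [y0|y_neq0] := eqVneq (nr y) 0.
  by rewrite y0 mulr0 (nr_eq0 y0) dot0r nr0.
have ny : 0 < nr y ^+ 2 by rewrite exprn_gt0// lt_neqAle eq_sym y_neq0 nr_ge0.
(* The subtracted multiple of [y] is the orthogonal projection of [x] onto the line through [y]. *)
have ge0 : 0 <= nr (x + (- ((nr y ^- 2)%:C * dot x y)) *: y) ^+ 2.
  by rewrite exprn_ge0 ?nr_ge0.
rewrite nrD_sqr nrZ dotZr nrN nrM nr_real rmorphN rmorphM/= in ge0.
rewrite mulNr -(mulrA _ (dot x y)^* (dot x y)) [_^* * dot x y]mulrC mul_conj in ge0.
move: ge0; have -> : ((nr y ^- 2)%:C)^* = (nr y ^- 2)%:C.
  by apply: conj_Creal; rewrite complex_real.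
rewrite -rmorphM -rmorphN/= ger0_norm ?invr_ge0 ?(ltW ny)// => ge0.
rewrite -ler_sqr ?nnegrE ?mulr_ge0 ?nr_ge0// exprMn -ler_pdivrMr//.
have := ge0; rewrite !exprMn; set u := nr (dot x y); set v := nr y ^+ 2.
have -> : v^-1 ^+ 2 * u ^+ 2 * v = u ^+ 2 / v by field; rewrite gt_eqF.
lra.
Qed.

End Hilbert.

(** A positive element of [R[i]] is real, so the balls around a point can be indexed by radii in
    [R]. *)
Lemma nbhs_nrP (R : realType) (V : normedModType R[i]) (x : V) (B : set V) :
  nbhs x B <-> exists2 e : R, 0 < e & forall y, nr (x - y) < e -> B y.
Proof.
split=> [/nbhs_ballP[e /= e0 eB]|[e e0 eB]].
  have eE : e = (complex.Re e)%:C by rewrite RRe_real// gtr0_real.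
  exists (complex.Re e); first by rewrite -ltcR -eE.
  by move=> y xy; apply: eB; rewrite -ball_normE/= normE eE ltcR.
apply/nbhs_ballP; exists e%:C; first by rewrite /= ltcR.
by move=> y; rewrite -ball_normE/= normE ltcR => /eB.
Qed.

Lemma closed_nrP (R : realType) (V : normedModType R[i]) (W : set V) :
  closed W <->
  forall x, (forall e : R, 0 < e -> exists2 y, W y & nr (x - y) < e) -> W x.
Proof.
split=> [Wc x xW|WP x xW].
  apply: Wc => B /nbhs_nrP[e e0 eB].
  by have [y Wy /eB By] := xW _ e0; exists y.
apply: WP => e e0; have /xW[y [Wy /= xy]] : nbhs x [set y | nr (x - y) < e].
  by apply/nbhs_nrP; exists e.
by exists y.
Qed.

Lemma dense_nr (R : realType) (V : normedModType R[i]) (D : set V) : dense D ->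
  forall x (e : R), 0 < e -> exists2 y, D y & nr (x - y) < e.
Proof.
move=> dD x e e0; have oB : open [set y : V | nr (x - y) < e].
  rewrite openE => y /= xy; apply/nbhs_nrP; exists (e - nr (x - y)).
    by rewrite subr_gt0.
  move=> z yz /=; rewrite -(subrKA y).
  by have := nrD (x - y) (y - z); lra.
have [|y [/= xy Dy]] := dD _ _ oB; first by exists x => /=; rewrite subrr nr0.
by exists y.
Qed.

Lemma continuous_nrP (R : realType) (V W : normedModType R[i]) (T : V -> W) :
  linear T -> continuous T <-> exists2 C : R, 0 <= C & forall x, nr (T x) <= C * nr x.
Proof.
move=> linT.
have T0 : T 0 = 0 by have := linT (-1) 0 0; rewrite scaler0 addr0 scaleN1r addNr.
have TZ a x : T (a *: x) = a *: T x by have := linT a x 0; rewrite T0 !addr0.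
have TB x y : T (x - y) = T x - T y.
  by rewrite -scaleN1r [x + _]addrC linT scaleN1r addrC.
split=> [cT|[C C0 CT] x].
  have /nbhs_nrP[e e0 eT] : nbhs (0 : V) (T @^-1` [set y | nr y < 1]).
    apply: (cT 0); apply/nbhs_nrP; exists 1 => // y.
    by rewrite T0 sub0r nrN.
  exists (2 / e); first by rewrite divr_ge0// ltW.
  move=> x; have [/nr_eq0 ->|x0] := eqVneq (nr x) 0.
    by rewrite T0 !nr0 mulr0.
  have x_gt0 : 0 < nr x by rewrite lt_neqAle eq_sym x0 nr_ge0.
  (* This factor scales [x] to norm [e / 2], inside the ball on which [T] has norm below 1; hence
     the constant [2 / e]. *)
  have c0 : 0 < e / 2 / nr x by rewrite !divr_gt0.
  have := eT ((e / 2 / nr x)%:C *: x).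
  rewrite sub0r nrN /= TZ !nrZ nr_real gtr0_norm// divfK// => h.
  have {}h : e / 2 / nr x * nr (T x) <= 1 by apply/ltW/h; lra.
  have -> : nr (T x) = 2 / e * nr x * (e / 2 / nr x * nr (T x)).
    by field; rewrite x0 gt_eqF.
  by rewrite ler_piMr// mulr_ge0 ?nr_ge0// divr_ge0// ltW.
move=> B /nbhs_nrP[e e0 eB]; apply/nbhs_nrP.
(* [C] may be 0, hence the denominator [C + 1]; the same device recurs whenever a tolerance is
   pulled back through a bounded operator. *)
exists (e / (C + 1)); first by rewrite divr_gt0// ltr_wpDl.
move=> y xy; apply: eB; rewrite -TB (le_lt_trans (CT _))//.
move: xy; rewrite ltr_pdivlMr ?ltr_wpDl// => xy.
by have := nr_ge0 (x - y); lra.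
Qed.

Lemma complete_nr (R : realType) (V : completeNormedModType R[i]) (u : nat -> V) :
  (forall e : R, 0 < e -> exists n, forall m, (n <= m)%N -> nr (u n - u m) < e) ->
  exists l, forall e : R, 0 < e -> exists n, forall m, (n <= m)%N -> nr (l - u m) < e.
Proof.
move=> cu; have cvu : cvg (u @ \oo).
  apply/cauchy_cvgP/cauchy_exP => e e0.
  have eE : e = (complex.Re e)%:C by rewrite RRe_real// gtr0_real.
  have /cu[n un] : 0 < complex.Re e by rewrite -ltcR -eE.
  exists (u n); exists n => // m /= nm.
  by rewrite -ball_normE/= normE eE ltcR un.
exists (lim (u @ \oo)) => e e0.
have [|n _ nu] := cvu [set y | nr (lim (u @ \oo) - y) < e].
  by apply/nbhs_nrP; exists e.
by exists n => m /nu.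
Qed.

Lemma invS_lt (R : realType) (e : R) : 0 < e -> exists n, forall m, (n <= m)%N -> m.+1%:R^-1 < e.
Proof.
by move=> e0; have [n _ nP] := near_infty_natSinv_lt (PosNum e0); exists n => m /nP.
Qed.

Lemma re_mul_conj_l (R : realType) (a b : R[i]) (t : R) :
  complex.Re ((t%:C * a)^* * b) = t * complex.Re (a^* * b).
Proof. by case: a b => a1 a2 [b1 b2] /=; ring. Qed.

(** * Orthogonal projections and bounded maps *)

Section Projection.
Variables (R : realType) (H : hilbertType R) (n : nat).
Implicit Types f g h : 'I_n -> H.

(** Inner product and squared norm of the Hilbert space H^n; limits in it are taken coordinate by
    coordinate. *)
Definition tuple_dot f g := \sum_i dot (f i) (g i).
Definition tuple_sqnorm f : R := \sum_i nr (f i) ^+ 2.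

Lemma tuple_sqnorm_ge0 f : 0 <= tuple_sqnorm f.
Proof. by apply: sumr_ge0 => i _; rewrite exprn_ge0 ?nr_ge0. Qed.

(** Parallelogram law for [f - g] and [f - h], arranged around the midpoint of [g] and [h]: two near
    minimizers of the distance from [f] to a convex set are close to each other, since their
    midpoint is no nearer than the distance. *)
Lemma tuple_parallelogram f g h :
  tuple_sqnorm (fun i => g i - h i) =
  2 * tuple_sqnorm (fun i => f i - g i) + 2 * tuple_sqnorm (fun i => f i - h i)
  - 4 * tuple_sqnorm (fun i => f i - (2%:R^-1 *: g i + 2%:R^-1 *: h i)).
Proof.
rewrite /tuple_sqnorm !mulr_sumr -big_split/= -sumrB; apply: eq_bigr => i _.
set x := f i - g i; set y := f i - h i.
have -> : f i - (2%:R^-1 *: g i + 2%:R^-1 *: h i) = (2^-1)%:C *: (x + y).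
  rewrite fmorphV rmorph_nat /x /y addrACA -opprD scalerBr -scalerDr.
  by rewrite -[f i + f i]mulr2n -[f i *+ 2]scaler_nat scalerA mulVf ?pnatr_eq0// scale1r.
have -> : g i - h i = y - x by rewrite /x /y opprB [RHS]addrC subrKA.
rewrite -/x -/y nrZ nr_real ger0_norm ?invr_ge0// exprMn.
clearbody x y; rewrite !nrD_sqr nrN dotNr raddfN/=.
by rewrite (Re_dotC y x); field.
Qed.

Lemma tuple_sqnorm_sub f h (a : R[i]) :
  tuple_sqnorm (fun i => f i - a *: h i) =
  tuple_sqnorm f - 2 * complex.Re (a^* * tuple_dot f h) + nr a ^+ 2 * tuple_sqnorm h.
Proof.
rewrite /tuple_sqnorm /tuple_dot !mulr_sumr raddf_sum mulr_sumr -sumrB -big_split/=.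
apply: eq_bigr => i _; rewrite nrD_sqr nrN nrZ exprMn dotNr dotZr raddfN/=.
by rewrite mulrN addrAC.
Qed.

Theorem projection_exists (W : set ('I_n -> H)) :
  W (fun=> 0) ->
  (forall a f g, W f -> W g -> W (fun i => a *: f i + g i)) ->
  (forall f, (forall e : R, 0 < e ->
     exists2 g, W g & forall i, nr (f i - g i) < e) -> W f) ->
  forall f, exists2 g, W g &
    forall h, W h -> tuple_dot (fun i => f i - g i) h = 0.
Proof.
move=> W0 WL Wc f.
pose S := [set tuple_sqnorm (fun i => f i - g i) | g in W].
have hS : has_inf S.
  split; first by exists (tuple_sqnorm (fun i => f i - 0)), (fun=> 0).
  by exists 0 => _ [g _ <-]; exact: tuple_sqnorm_ge0.
pose d := inf S.
have dle g : W g -> d <= tuple_sqnorm (fun i => f i - g i).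
  by move=> Wg; apply: ge_inf; [exact: hS.2|exists g].
have /choice[u uP] : forall k : nat, exists g, W g /\
    tuple_sqnorm (fun i => f i - g i) < d + k.+1%:R^-1.
  move=> k; have [|_ [g Wg <-] gd] := @inf_adherent _ S k.+1%:R^-1 _ hS.
    by rewrite invr_gt0.
  by exists g.
have uW k := (uP k).1.
have [l lP] : exists l : 'I_n -> H, forall i (e : R), 0 < e ->
    exists k, forall m, (k <= m)%N -> nr (l i - u m i) < e.
  suff /choice[l lP] : forall i, exists l : H, forall e : R, 0 < e ->
      exists k, forall m, (k <= m)%N -> nr (l - u m i) < e by exists l.
  move=> i.
  apply: (@complete_nr _ _ (fun m => u m i)) => e e0.
  (* The midpoint of [u k] and [u m] has squared distance at least [d] from [f], so theirs from each
     other is below 2/(k+1) + 2/(m+1). *)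
  have [|k kP] := @invS_lt R (e ^+ 2 / 4); first by rewrite divr_gt0 ?exprn_gt0.
  exists k => m km; rewrite -ltr_sqr ?nnegrE ?nr_ge0 ?(ltW e0)//.
  apply: (@le_lt_trans _ _ (tuple_sqnorm (fun i => u k i - u m i))).
    rewrite /tuple_sqnorm (bigD1 i)//= ler_wpDr// sumr_ge0// => j _.
    by rewrite exprn_ge0 ?nr_ge0.
  rewrite (tuple_parallelogram f).
  have h1 := (uP k).2; have h2 := (uP m).2.
  have h3 : d <= tuple_sqnorm (fun i => f i - (2%:R^-1 *: u k i + 2%:R^-1 *: u m i)).
    apply: dle; apply: (WL _ _ (fun i => 2%:R^-1 *: u m i)) => //.
    have := WL 2%:R^-1 _ _ (uW m) W0; congr W.
    by apply/funext => j; rewrite addr0.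
  have k1 := kP k (leqnn _); have k2 := kP m km.
  move: h1 h2 h3 k1 k2.
  set A := tuple_sqnorm _; set B := tuple_sqnorm _; set C := tuple_sqnorm _.
  by move: k.+1%:R^-1 m.+1%:R^-1 (e ^+ 2) => a b c; lra.
have Wl : W l.
  apply: Wc => e e0.
  have /choice[k kP] : forall i, exists k, forall m, (k <= m)%N -> nr (l i - u m i) < e.
    by move=> i; apply: lP.
  exists (u (\max_i k i)%N) => // i; apply: kP.
  by apply: leq_bigmax.
exists l => // h Wh.
apply/nr_eq0/eqP; rewrite eq_le nr_ge0 andbT; apply/ler_addgt0Pr => e e0.
rewrite add0r.
pose B := tuple_sqnorm h + 1.
have B1 : 1 <= B by rewrite /B lerDr tuple_sqnorm_ge0.
pose M := \sum_i nr (h i) + 1.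
have M1 : 1 <= M by rewrite /M lerDr sumr_ge0// => i _; exact: nr_ge0.
have [|k1 k1P] := @invS_lt R ((e / 2) ^+ 2 / B).
  by rewrite divr_gt0 ?exprn_gt0 ?divr_gt0//; lra.
have /choice[k kP] : forall i, exists k, forall m, (k <= m)%N ->
    nr (l i - u m i) < e / 2 / M.
  by move=> i; apply: lP; rewrite !divr_gt0//; lra.
pose m := maxn k1 (\max_i k i)%N.
have -> : tuple_dot (fun i => f i - l i) h =
    tuple_dot (fun i => f i - u m i) h - tuple_dot (fun i => l i - u m i) h.
  rewrite /tuple_dot -sumrB; apply: eq_bigr => i _.
  by rewrite -dotBl opprB addrA subrK.
rewrite (le_trans (nrD _ _))// nrN [leRHS](splitr e) lerD//.
  set q := tuple_dot _ _; pose t := B^-1.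
  rewrite -ler_sqr ?nnegrE ?nr_ge0 ?divr_ge0// ?(ltW e0)//.
  (* Moving [u m] along [h] by [t * q] lowers the squared distance by at least t |q|^2, because t
     |h|^2 <= 1. It is already within 1/(m+1) of the infimum, and 1/(m+1) < (e/2)^2 t. *)
  have : d <= tuple_sqnorm (fun i => (f i - u m i) - (t%:C * q) *: h i).
    have := dle (fun i => (t%:C * q) *: h i + u m i) (WL _ _ _ Wh (uW m)).
    congr (_ <= tuple_sqnorm _); apply/funext => i.
    by rewrite [_ *: _ + _]addrC opprD addrA.
  rewrite tuple_sqnorm_sub re_mul_conj_l -/q [q^* * q]mulrC mul_conj nrM nr_real.
  have t0 : 0 < t by rewrite invr_gt0; lra.
  rewrite gtr0_norm//= exprMn.
  have := (uP m).2; have := k1P m (leq_maxl _ _).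
  have tB : t * tuple_sqnorm h <= 1 by rewrite /t mulrC ler_pdivrMr ?mul1r ?lerDl//; lra.
  move: m.+1%:R^-1 (tuple_sqnorm (fun i => f i - u m i)) => a N aB Na dN.
  have : t * nr q ^+ 2 * (t * tuple_sqnorm h) <= t * nr q ^+ 2.
    by rewrite ler_piMr// mulr_ge0 ?exprn_ge0 ?nr_ge0// ltW.
  have : a < (e / 2) ^+ 2 * t by [].
  rewrite -(ler_pM2r t0) => a1 a2.
  have -> : nr q ^+ 2 * t = t * nr q ^+ 2 by rewrite mulrC.
  have : t ^+ 2 * nr q ^+ 2 * tuple_sqnorm h = t * nr q ^+ 2 * (t * tuple_sqnorm h) by ring.
  move: dN a1 a2.
  set X := _ * tuple_sqnorm h; set Y := t * nr q ^+ 2 * _; set Z := t * nr q ^+ 2.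
  by move: ((e / 2) ^+ 2 * t) => c; lra.
apply: (@le_trans _ _ (\sum_i e / 2 / M * nr (h i))).
  rewrite /tuple_dot; elim/big_rec2: _ => [|i y1 y2 _ le12]; first by rewrite nr0.
  rewrite (le_trans (nrD _ _))// lerD//.
  rewrite (le_trans (cauchy_schwarz _ _))// ler_wpM2r ?nr_ge0// ltW// kP//.
  by rewrite (leq_trans _ (leq_maxr _ _))// leq_bigmax.
rewrite -mulr_sumr -mulrA ler_piMr ?divr_ge0 ?(ltW e0)//.
by rewrite mulrC ler_pdivrMr ?mul1r ?lerDl//; lra.
Qed.
End Projection.

Lemma le_eps (R : realType) (a : R) (C : R) :
  (forall e : R, 0 < e -> a <= C * e) -> a <= 0.
Proof.
move=> aP; apply/ler_addgt0Pr => e e0; rewrite add0r.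
have C1 : 0 < `|C| + 1 by rewrite ltr_wpDl.
have /aP/le_trans : 0 < e / (`|C| + 1) by rewrite divr_gt0.
apply; rewrite mulrA ler_pdivrMr//.
by have := ler_norm C; nra.
Qed.

Lemma nr_eps (R : realType) (V : normedZmodType R[i]) (x : V) (C : R) :
  (forall e : R, 0 < e -> nr x <= C * e) -> x = 0.
Proof.
by move=> xP; apply/nr_eq0/eqP; rewrite eq_le nr_ge0 andbT (le_eps xP).
Qed.

Section LinearMaps.
Variable (R : realType).
Implicit Types (H : hilbertType R).

Lemma linear_map0 H H' (T : H -> H') : linear T -> T 0 = 0.
Proof. by move=> lT; have := lT (-1) 0 0; rewrite scaler0 addr0 scaleN1r addNr. Qed.
Lemma linear_mapZ H H' (T : H -> H') a x : linear T -> T (a *: x) = a *: T x.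
Proof. by move=> lT; have := lT a x 0; rewrite (linear_map0 lT) !addr0. Qed.
Lemma linear_mapD H H' (T : H -> H') x y : linear T -> T (x + y) = T x + T y.
Proof. by move=> lT; have := lT 1 x y; rewrite !scale1r. Qed.
Lemma linear_mapN H H' (T : H -> H') x : linear T -> T (- x) = - T x.
Proof. by move=> lT; rewrite -scaleN1r linear_mapZ// scaleN1r. Qed.
Lemma linear_mapB H H' (T : H -> H') x y : linear T -> T (x - y) = T x - T y.
Proof. by move=> lT; rewrite linear_mapD// linear_mapN. Qed.

Lemma re_dot_inj H H' (x y : H) (x' y' : H') :
  (forall a, complex.Re (dot (a *: x) y) = complex.Re (dot (a *: x') y')) ->
  dot x y = dot x' y'.
Proof.
move=> h; have h1 := h 1; have hi := h 'i%C.
rewrite !scale1r !dotZl in h1 hi.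
move: h1 hi; case: (dot x y) (dot x' y') => a b [c d] /= h1 hi.
by congr (_ +i* _); move: h1 hi; rewrite !mul0r !mul1r ?subr0 !sub0r => ? /oppr_inj.
Qed.

Lemma isometry_dot H H' (T : H -> H') : linear T ->
  (forall x, nr (T x) = nr x) -> forall x y, dot (T x) (T y) = dot x y.
Proof.
move=> lT nT x y; apply: re_dot_inj => a; rewrite -(linear_mapZ _ _ lT).
have := nrD_sqr (T (a *: x)) (T y); rewrite -(linear_mapD _ _ lT) !nT nrD_sqr.
by move=> /addrI; lra.
Qed.

(** The vector [z] is the part of [z0] orthogonal to the kernel of [f], found by [projection_exists]
    on tuples of length one. The vector f(z) x - f(x) z lies in the kernel, and its orthogonality to
    [z] determines f(x). *)
Lemma riesz H (f : H -> R[i]) (C : R) :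
  (forall a x y, f (a *: x + y) = a * f x + f y) ->
  (forall x, nr (f x) <= C * nr x) -> exists g, forall x, f x = dot x g.
Proof.
move=> lf bf.
have f0 : f 0 = 0 by have := lf (-1) 0 0; rewrite scaler0 addr0 mulN1r addNr.
have fB x y : f (x - y) = f x - f y.
  by rewrite -scaleN1r [x + _]addrC lf mulN1r addrC.
have [fz|] := pselect (forall x, f x = 0).
  by exists 0 => x; rewrite dot0r fz.
move/existsNP => [z0 /eqP fz0].
have [] := @projection_exists R H 1%N [set F | f (F ord0) = 0] _ _ _ (fun=> z0) => //=.
- by move=> a F G F0 G0; rewrite lf F0 G0 mulr0 addr0.
- move=> F FP; apply: (@nr_eps _ _ _ `|C|) => e e0; have [G G0 /(_ ord0) FG] := FP e e0.
  rewrite -[f _]subr0 -G0 -fB (le_trans (bf _))//.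
  apply: le_trans (ler_wpM2l (normr_ge0 C) (ltW FG)).
  by rewrite ler_wpM2r ?nr_ge0// ler_norm.
move=> k k0 kP; pose z := z0 - k ord0.
have fz : f z != 0 by rewrite fB k0 subr0.
have z0' : dot z z != 0.
  by apply: contra_neq fz => /dot_eq0 ->.
exists ((f z / dot z z)^* *: z) => x.
have /(kP (fun=> _)) : f (f z *: x - f x *: z) = 0.
  rewrite fB -[f z *: x]addr0 lf f0 -[f x *: z]addr0 lf f0.
  by rewrite !addr0 mulrC subrr.
rewrite /tuple_dot big_ord1 -/z dotC => /(congr1 Num.conj).
rewrite conjCK rmorph0 dotBl !dotZl => /eqP; rewrite subr_eq0 => /eqP h.
by rewrite dotZr conjCK -mulrA [_^-1 * _]mulrC mulrA h mulfK.
Qed.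

Lemma adjoint_exists H (T : H -> H) : bounded_op T -> exists T', adjoint T T'.
Proof.
move=> [lT /(continuous_nrP lT)[C C0 bT]].
suff /choice[T' T'P] : forall y, exists g, forall x, dot (T x) y = dot x g.
  by exists T' => x y; exact: T'P.
move=> y; apply: (@riesz _ _ (C * nr y)) => [a u v|x].
  by rewrite lT dotDl dotZl.
rewrite (le_trans (cauchy_schwarz _ _))// mulrAC.
by rewrite ler_wpM2r ?nr_ge0.
Qed.

Lemma adjoint_sym H (S T : H -> H) : adjoint S T -> adjoint T S.
Proof. by move=> ST x y; rewrite dotC -ST dotC conjCK. Qed.

Lemma dot_inj H (x y : H) : (forall z, dot x z = dot y z) -> x = y.
Proof.
by move=> h; apply/subr0_eq/dot_eq0; rewrite dotBl h subrr.
Qed.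

Lemma adjoint_linear H (S T : H -> H) : adjoint S T -> linear S.
Proof.
move=> ST a x y; apply: dot_inj => z; rewrite ST !dotDl !dotZl -!ST.
by [].
Qed.

(** The operators to be built are prescribed on vectors such as [L2_vec E S], where [S] is not part
    of the data of the vector. A graph needs no choice of [S], and the norm bound makes it
    single-valued. *)
Lemma extend_relation H H' (G : H -> H' -> Prop) (C : R) : 0 <= C ->
  (forall a x x' y y', G x y -> G x' y' -> G (a *: x + x') (a *: y + y')) ->
  (forall x y, G x y -> nr y <= C * nr x) ->
  (forall x (e : R), 0 < e -> exists x' y', G x' y' /\ nr (x - x') < e) ->
  exists T, [/\ linear T, forall x, nr (T x) <= C * nr x & forall x y, G x y -> T x = y].
Proof.
move=> C0 lG bG dG.
have G0 : G 0 0.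
  have [x [y [Gxy _]]] := dG 0 1 ltr01.
  by have := lG (-1) _ _ _ _ Gxy Gxy; rewrite !scaleN1r !addNr.
have GB x x' y y' : G x y -> G x' y' -> G (x - x') (y - y').
  by move=> g g'; have := lG (-1) _ _ _ _ g' g; rewrite !scaleN1r [- x' + _]addrC [- y' + _]addrC.
(* [K] is the closure of the graph [G]; the bound passes to it and makes it everywhere defined and
   single-valued. *)
pose K x y := forall e : R, 0 < e -> exists x' y', [/\ G x' y', nr (x - x') < e & nr (y - y') < e].
have Kb x y : K x y -> nr y <= C * nr x.
  move=> Kxy; rewrite -subr_le0; apply: (@le_eps _ _ (C + 1)) => e /Kxy[x' [y' [/bG g xx yy]]].
  have h1 := nrD (y - y') y'; rewrite subrK in h1.
  have h2 := nrD (x' - x) x; rewrite subrK nrB in h2.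
  have : C * nr x' <= C * (e + nr x) by rewrite ler_wpM2l//; lra.
  lra.
have lK a x x' y y' : K x y -> K x' y' -> K (a *: x + x') (a *: y + y').
  move=> Kxy Kxy' e e0.
  have a1 : 0 < nr a + 1 by rewrite ltr_wpDl ?nr_ge0.
  have [|u [v [g1 u1 v1]]] := Kxy (e / 2 / (nr a + 1)); first by rewrite !divr_gt0.
  have [|u' [v' [g2 u2 v2]]] := Kxy' (e / 2); first by rewrite !divr_gt0.
  have aux (V : normedModType R[i]) (p q p' q' : V) : nr (p - q) < e / 2 / (nr a + 1) ->
      nr (p' - q') < e / 2 -> nr (a *: p + p' - (a *: q + q')) < e.
    move=> h1 h2; rewrite opprD addrACA -scalerBr (le_lt_trans (nrD _ _))//.
    rewrite nrZ; move: h1; rewrite ltr_pdivlMr// => h1.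
    by have := nr_ge0 (p - q); lra.
  by exists (a *: u + u'), (a *: v + v'); split; [exact: lG|exact: aux|exact: aux].
have KT x : exists y, K x y.
  have /choice[w wP] : forall k : nat, exists w : H * H', G w.1 w.2 /\ nr (x - w.1) < k.+1%:R^-1.
    move=> k; have [|x' [y' []]] := dG x k.+1%:R^-1; first by rewrite invr_gt0.
    by exists (x', y').
  have [|l lP] := @complete_nr _ _ (fun k => (w k).2).
    move=> e e0.
    have [|k kP] := @invS_lt R (e / 2 / (C + 1)).
      by rewrite !divr_gt0// ltr_wpDl.
    exists k => m km; have := bG _ _ (GB _ _ _ _ (wP k).1 (wP m).1).
    move=> /le_lt_trans; apply.
    have := nrD ((w k).1 - x) (x - (w m).1); rewrite subrKA (nrB _ x).
    have := (wP k).2; have := (wP m).2.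
    have := kP k (leqnn _); have := kP m km.
    move: k.+1%:R^-1 m.+1%:R^-1 => a b; rewrite !ltr_pdivlMr ?ltr_wpDl//.
    set X := nr (x - (w k).1); set Y := nr (x - (w m).1); set Z := nr (_ - _) => h1 h2 h3 h4 h5.
    have : C * Z <= C * (a + b) by rewrite ler_wpM2l//; lra.
    have : 0 <= a by apply: le_trans (ltW h4); exact: nr_ge0.
    have : 0 <= b by apply: le_trans (ltW h3); exact: nr_ge0.
    lra.
  exists l => e e0; have [k1 k1P] := lP _ e0; have [k2 k2P] := invS_lt e0.
  pose m := maxn k1 k2; exists (w m).1, (w m).2.
  split; [exact: (wP m).1| |exact: k1P (leq_maxl _ _)].
  by apply: lt_trans (wP m).2 _; apply: k2P; exact: leq_maxr.
have Ku x y y' : K x y -> K x y' -> y = y'.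
  move=> h h'; have /Kb := lK (-1) _ _ _ _ h' h.
  rewrite !scaleN1r addNr nr0 mulr0 addrC => yy'.
  by apply/subr0_eq/nr_eq0/eqP; rewrite eq_le yy' nr_ge0.
have [T TP] := choice KT; exists T; split.
- by move=> a x y; apply: Ku (TP _) _; exact: lK.
- by move=> x; exact: Kb.
move=> x y g; apply: Ku (TP _) _ => e e0; exists x, y; split=> //.
  by rewrite subrr nr0.
by rewrite subrr nr0.
Qed.

(** An isometric graph extends in both directions when its domain and its range are dense; the
    extensions are inverse to each other because they are so on the graph. *)
Lemma unitary_relation H H' (G : H -> H' -> Prop) :
  (forall a x x' y y', G x y -> G x' y' -> G (a *: x + x') (a *: y + y')) ->
  (forall x y, G x y -> nr y = nr x) ->
  (forall x (e : R), 0 < e -> exists x' y', G x' y' /\ nr (x - x') < e) ->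
  (forall y (e : R), 0 < e -> exists x' y', G x' y' /\ nr (y - y') < e) ->
  exists (U : H -> H') (U' : H' -> H),
  [/\ linear U, linear U', cancel U U', cancel U' U &
      [/\ forall x, nr (U x) = nr x, forall y, nr (U' y) = nr y &
          forall x y, G x y -> U x = y]].
Proof.
move=> lG bG d1 d2.
have bG1 x y : G x y -> nr y <= 1 * nr x by move=> /bG ->; rewrite mul1r.
have [U [lU bU UG]] := extend_relation ler01 lG bG1 d1.
have bG2 x y : G y x -> nr y <= 1 * nr x by move=> /bG ->; rewrite mul1r.
have d3 y (e : R) : 0 < e -> exists y' x', G x' y' /\ nr (y - y') < e.
  by move=> /(d2 y)[x' [y' ?]]; exists y', x'.
have [U' [lU' bU' UG']] := extend_relation ler01 (fun a x x' y y' => @lG a y y' x x') bG2 d3.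
have UK : cancel U U'.
  move=> x; apply/subr0_eq/(@nr_eps _ _ _ 2) => e e0.
  have [x' [y' [g xx]]] := d1 x e e0.
  have -> : U' (U x) - x = U' (U (x - x')) - (x - x').
    rewrite (linear_mapB _ _ lU) (linear_mapB _ _ lU') (UG _ _ g) (UG' _ _ g).
    by rewrite opprB subrKA.
  have h1 := bU' (U (x - x')); have h2 := bU (x - x'); rewrite !mul1r in h1 h2.
  by rewrite (le_trans (nrD _ _))// nrN; lra.
have UK' : cancel U' U.
  move=> x; apply/subr0_eq/(@nr_eps _ _ _ 2) => e e0.
  have [y' [x' [g xx]]] := d2 x e e0.
  have -> : U (U' x) - x = U (U' (x - x')) - (x - x').
    rewrite (linear_mapB _ _ lU') (linear_mapB _ _ lU) (UG' _ _ g) (UG _ _ g).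
    by rewrite opprB subrKA.
  have h1 := bU (U' (x - x')); have h2 := bU' (x - x'); rewrite !mul1r in h1 h2.
  by rewrite (le_trans (nrD _ _))// nrN; lra.
exists U, U'; split=> //; split=> // x; apply/eqP; rewrite eq_le.
  by have := bU x; have := bU' (U x); rewrite !mul1r UK => -> ->.
by have := bU' x; have := bU (U' x); rewrite !mul1r UK' => -> ->.
Qed.

End LinearMaps.

Section BoundedOperators.
Variables (R : realType) (H : hilbertType R).
Implicit Types (S T : H -> H) (A M : set (H -> H)).

Lemma bounded_opP T : bounded_op T <->
  linear T /\ exists2 C : R, 0 <= C & forall x, nr (T x) <= C * nr x.
Proof.
by split=> -[lT bT]; split=> //; move/(continuous_nrP lT): bT.
Qed.

Lemma bounded_op_id : bounded_op (@id H).
Proof. by apply/bounded_opP; split=> [//|]; exists 1 => // x; rewrite mul1r. Qed.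

Lemma bounded_op_linear a S T : bounded_op S -> bounded_op T -> bounded_op (a *: S + T).
Proof.
move=> /bounded_opP[lS [C C0 bS]] /bounded_opP[lT [D D0 bT]]; apply/bounded_opP; split.
  move=> b x y; rewrite !fctE lS lT; rewrite !scalerDr !scalerA mulrC.
  by rewrite addrACA.
exists (nr a * C + D) => [|x]; first by rewrite addr_ge0// mulr_ge0 ?nr_ge0.
rewrite !fctE (le_trans (nrD _ _))// nrZ mulrDl -mulrA lerD//.
by rewrite ler_wpM2l ?nr_ge0.
Qed.

Lemma bounded_op0 : bounded_op (0 : H -> H).
Proof.
apply/bounded_opP; have -> : (0 : H -> H) = fun=> 0 by [].
split=> [a x y|]; first by rewrite scaler0 addr0.
by exists 0 => // x; rewrite nr0 mul0r.
Qed.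

Lemma bounded_op_comp S T : bounded_op S -> bounded_op T -> bounded_op (S \o T).
Proof.
move=> /bounded_opP[lS [C C0 bS]] /bounded_opP[lT [D D0 bT]]; apply/bounded_opP; split.
  by move=> a x y /=; rewrite lT lS.
exists (C * D) => [|x]; first by rewrite mulr_ge0.
by rewrite -mulrA (le_trans (bS _))// ler_wpM2l.
Qed.

Lemma commutant_subalgebra A : A `<=` @bounded_op R H ->
  subalgebra (commutant A) /\ commutant A id.
Proof.
move=> Ab; split; last by split; [exact: bounded_op_id|].
split=> [T []//| | |].
- split=> [|S AS]; first exact: bounded_op0.
  have /bounded_opP[lS _] := Ab _ AS.
  by apply/funext => x; rewrite /= (linear_map0 lS).
- move=> a S T [bS cS] [bT cT]; split=> [|U AU]; first exact: bounded_op_linear.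
  have /bounded_opP[lU _] := Ab _ AU.
  apply/funext => x; rewrite /= !fctE lU.
  have /(congr1 (@^~ x))/= -> := cS _ AU.
  by have /(congr1 (@^~ x))/= -> := cT _ AU.
move=> S T [bS cS] [bT cT]; split=> [|U AU]; first exact: bounded_op_comp.
by rewrite -compA cT// compA cS// compA.
Qed.

Lemma commutant_bounded A : commutant A `<=` @bounded_op R H.
Proof. by move=> T []. Qed.

Lemma sub_bicommutant A : A `<=` @bounded_op R H -> A `<=` commutant (commutant A).
Proof. by move=> Ab T AT; split=> [|S [_ cS]]; [exact: Ab|rewrite cS]. Qed.

Lemma linear_eq_dense (V : normedZmodType R[i]) (f : H -> V) (C : R) (D : set H) :
  (forall x y, f (x - y) = f x - f y) -> (forall x, nr (f x) <= C * nr x) ->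
  (forall x (e : R), 0 < e -> exists2 y, D y & nr (x - y) < e) ->
  (forall x, D x -> f x = 0) -> forall x, f x = 0.
Proof.
move=> fB bf dD f0 x; apply: (@nr_eps _ _ _ `|C|) => e e0.
have [y Dy xy] := dD x e e0.
rewrite -[f x]subr0 -(f0 _ Dy) -fB (le_trans (bf _))//.
by rewrite (le_trans (ler_wpM2r (nr_ge0 _) (ler_norm C)))// ler_wpM2l// ltW.
Qed.

End BoundedOperators.

Lemma bounded_op_bound (R : realType) (H : hilbertType R) (T : H -> H) :
  bounded_op T -> exists2 C : R, 0 <= C & forall x, nr (T x) <= C * nr x.
Proof. by move=> /bounded_opP[]. Qed.

Lemma bounded_op_lin (R : realType) (H : hilbertType R) (T : H -> H) :
  bounded_op T -> linear T.
Proof. by case. Qed.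

Lemma eq_dense (R : realType) (H : hilbertType R) (S T : H -> H) (D : set H) :
  bounded_op S -> bounded_op T ->
  (forall x (e : R), 0 < e -> exists2 y, D y & nr (x - y) < e) ->
  (forall x, D x -> S x = T x) -> S = T.
Proof.
move=> bS bT dD ST; apply/funext => x; apply/subr0_eq; move: x.
have [C C0 bC] := bounded_op_bound bS; have [C' C'0 bC'] := bounded_op_bound bT.
apply: (@linear_eq_dense _ _ _ (fun x => S x - T x) (C + C') D) => //.
- move=> x y; rewrite (linear_mapB _ _ (bounded_op_lin bS)).
  by rewrite (linear_mapB _ _ (bounded_op_lin bT)) !opprD !opprK addrACA.
- by move=> x; rewrite (le_trans (nrD _ _))// nrN mulrDl lerD.
by move=> x /ST ->; rewrite subrr.
Qed.

Lemma adjoint_dense (R : realType) (H : hilbertType R) (S T : H -> H) (D : set H) :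
  bounded_op S -> bounded_op T ->
  (forall x (e : R), 0 < e -> exists2 y, D y & nr (x - y) < e) ->
  (forall x y, D x -> D y -> dot (S x) y = dot x (T y)) -> adjoint S T.
Proof.
move=> bS bT dD ST.
have [C C0 bC] := bounded_op_bound bS; have [C' C'0 bC'] := bounded_op_bound bT.
have lS := bounded_op_lin bS; have lT := bounded_op_lin bT.
have step y : D y -> forall x, dot (S x) y - dot x (T y) = 0.
  move=> Dy; apply: (@linear_eq_dense _ _ _ _ (C * nr y + nr (T y)) D) => //.
  - move=> u v; rewrite (linear_mapB _ _ lS) !dotBl.
    by rewrite !opprD !opprK addrACA.
  - move=> x; rewrite (le_trans (nrD _ _))// nrN mulrDl lerD//.
      by rewrite (le_trans (cauchy_schwarz _ _))// mulrAC ler_wpM2r ?nr_ge0.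
    by rewrite (le_trans (cauchy_schwarz _ _))// mulrC.
  by move=> x Dx; rewrite ST// subrr.
move=> x y; apply/subr0_eq/(can_inj (@conjCK _)); rewrite rmorph0; move: y.
apply: (@linear_eq_dense _ _ _ _ (nr (S x) + C' * nr x) D) => //.
- move=> u v; rewrite (linear_mapB _ _ lT) !dotBr -rmorphB; congr Num.conj.
  by rewrite !opprD !opprK addrACA.
- move=> y; rewrite nr_conj (le_trans (nrD _ _))// nrN mulrDl lerD//.
    exact: cauchy_schwarz.
  rewrite (le_trans (cauchy_schwarz _ _))// [C' * _]mulrC -mulrA.
  by rewrite ler_wpM2l ?nr_ge0.
by move=> y Dy; rewrite step// rmorph0.
Qed.

(** * Von Neumann algebras in standard form *)

Section VonNeumann.
Variables (R : realType) (K : hilbertType R) (M : set (K -> K)).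
Hypothesis vnM : von_neumann M.
Implicit Types (S T : K -> K).

Lemma vn_bicommutant : M = commutant (commutant M).
Proof. by case: vnM. Qed.

Lemma vn_subalgebra : subalgebra M /\ M id.
Proof. by rewrite vn_bicommutant; apply/commutant_subalgebra/commutant_bounded. Qed.

Lemma vn_id : M id.
Proof. by case: vn_subalgebra. Qed.

Lemma vn_linear a S T : M S -> M T -> M (a *: S + T).
Proof. by case: vn_subalgebra => -[_ _ + _] _; apply. Qed.

Lemma vn_comp S T : M S -> M T -> M (S \o T).
Proof. by case: vn_subalgebra => -[_ _ _ +] _; apply. Qed.

Lemma vn_adj S : M S -> exists2 S', M S' & adjoint S S'.
Proof. by case: vnM => + _; apply. Qed.

Lemma vn_D S T : M S -> M T -> M (S + T).
Proof.
move=> MS MT; have -> : S + T = (1 : R[i]) *: S + T by rewrite scale1r.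
exact: vn_linear.
Qed.

Lemma vn_B S T : M S -> M T -> M (S - T).
Proof.
move=> MS MT; have -> : S - T = (-1 : R[i]) *: T + S by rewrite scaleN1r addrC.
exact: vn_linear.
Qed.

End VonNeumann.

Lemma adjoint_comp (R : realType) (H : hilbertType R) (S S' T T' : H -> H) :
  adjoint S S' -> adjoint T T' -> adjoint (S \o T) (T' \o S').
Proof. by move=> SS TT x y /=; rewrite SS TT. Qed.

Section StandardForm.
Variables (R : realType) (K : hilbertType R) (M : set (K -> K)).
Variable (tau : (K -> K) -> R[i]).
Hypotheses (vnM : von_neumann M) (trM : faithful_normal_trace M tau).
Variable E : L2 M tau.
Local Notation v := (L2_vec E).
Local Notation L := (L2_mul E).
Local Notation xi := (v id).

Lemma L2_dense (x : E) (e : R) : 0 < e -> exists2 S, M S & nr (x - v S) < e.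
Proof.
move=> e0; have [_ [S MS <-] xS] := dense_nr (@L2_vec_dense _ _ _ _ E) x e0.
by exists S.
Qed.

Let vD := v @` M.
Let dD (x : E) (e : R) : 0 < e -> exists2 y, vD y & nr (x - y) < e.
Proof. by move=> e0; have [S MS xS] := L2_dense x e0; exists (v S) => //; exists S. Qed.

Lemma L2_mul_bound S : M S -> bounded_op (L S).
Proof. exact: L2_mul_bounded. Qed.

Lemma L2_vec_norm S S' : M S -> adjoint S S' -> (nr (v S) ^+ 2)%:C = tau (S' \o S).
Proof. by move=> MS SS; rewrite -dotx (L2_vec_dot E MS MS SS). Qed.

Lemma L2_xi_norm : dot xi xi = 1.
Proof.
rewrite (@L2_vec_dot _ _ _ _ E id id id) ?(tr_one trM)//; exact: vn_id.
Qed.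

Lemma L2_mul_xi S : M S -> L S xi = v S.
Proof. by move=> MS; rewrite (L2_mul_vec E (vn_id vnM) MS). Qed.

Lemma L2_mul_linear a S T : M S -> M T -> L (a *: S + T) = a *: L S + L T.
Proof.
move=> MS MT; have MST := vn_linear vnM a MS MT.
apply: (eq_dense _ _ dD).
- exact: L2_mul_bound.
- by apply: bounded_op_linear; exact: L2_mul_bound.
move=> _ [U MU <-]; rewrite !fctE !L2_mul_vec//.
rewrite -L2_vec_linear//; exact: vn_comp.
Qed.

Lemma L2_mul_comp S T : M S -> M T -> L (S \o T) = L S \o L T.
Proof.
move=> MS MT; have MST := vn_comp vnM MS MT.
apply: (eq_dense _ _ dD).
- exact: L2_mul_bound.
- by apply: bounded_op_comp; exact: L2_mul_bound.
by move=> _ [U MU <-]; rewrite /= !L2_mul_vec//; exact: vn_comp.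
Qed.

Lemma L2_mul_id : L id = id.
Proof.
have M1 := vn_id vnM.
apply: (eq_dense _ _ dD) => [||_ [U MU <-]]; last by rewrite L2_mul_vec.
- exact: L2_mul_bound.
- exact: bounded_op_id.
Qed.

Lemma L2_mul_adjoint S S' : M S -> M S' -> adjoint S S' -> adjoint (L S) (L S').
Proof.
move=> MS MS' SS.
apply: (adjoint_dense _ _ dD); [exact: L2_mul_bound|exact: L2_mul_bound|].
move=> _ _ [T MT <-] [U MU <-]; have [U' MU' UU] := vn_adj vnM MU.
rewrite !L2_mul_vec// (L2_vec_dot E _ MU UU); last exact: vn_comp.
rewrite (L2_vec_dot E MT (vn_comp vnM MS' MU) (adjoint_comp (adjoint_sym SS) UU)).
by rewrite compA.
Qed.

(** This is the trace property tau(S' S) = tau(S S') read in the 2-norm. *)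
Lemma L2_vec_adjoint_norm S S' : M S -> M S' -> adjoint S S' -> nr (v S') = nr (v S).
Proof.
move=> MS MS' SS; apply/eqP; rewrite -(@eqrXn2 _ 2)// ?nr_ge0//; apply/eqP/complexI.
rewrite (L2_vec_norm MS SS) (L2_vec_norm MS' (adjoint_sym SS)).
exact: (tr_comm trM).
Qed.

(* Traciality bounds the right multiplications: |S a|_2 = |a^* S^*|_2. *)
Lemma right_mul_exists a : M a ->
  exists T : E -> E, bounded_op T /\ forall S, M S -> T (v S) = v (S \o a).
Proof.
move=> Ma; have [a' Ma' aa] := vn_adj vnM Ma.
have [C C0 bC] := bounded_op_bound (L2_mul_bound Ma').
have [|||T [lT bT TP]] := @extend_relation _ _ _
  (fun x y => exists S, [/\ M S, x = v S & y = v (S \o a)]) _ C0.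
- move=> b _ _ _ _ [S [MS -> ->]] [T [MT -> ->]]; exists (b *: S + T).
  split; first exact: vn_linear.
    by rewrite L2_vec_linear.
  by rewrite -L2_vec_linear//; exact: vn_comp.
- move=> _ _ [S [MS -> ->]]; have [S' MS' SS] := vn_adj vnM MS.
  rewrite -(L2_vec_adjoint_norm (vn_comp vnM MS Ma) (vn_comp vnM Ma' MS') (adjoint_comp SS aa)).
  by rewrite -L2_mul_vec// -(L2_vec_adjoint_norm MS MS' SS).
- move=> x e e0; have [S MS xS] := L2_dense x e0.
  by exists (v S), (v (S \o a)); split=> //; exists S.
exists T; split; first by apply/bounded_opP; split=> //; exists C.
by move=> S MS; apply: TP; exists S.
Qed.

(** The fallback [id] is for arguments with no such operator; [right_mul_exists] rules this out for
    [a] in [M]. *)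
Definition right_mul a : E -> E :=
  if pselect (exists T : E -> E, bounded_op T /\ forall S, M S -> T (v S) = v (S \o a))
    is left aP then sval (cid aP) else id.

Lemma right_mulP a : M a ->
  bounded_op (right_mul a) /\ forall S, M S -> right_mul a (v S) = v (S \o a).
Proof.
by move=> /right_mul_exists; rewrite /right_mul; case: pselect => // aP _; case: cid.
Qed.

Lemma right_mul_bounded a : M a -> bounded_op (right_mul a).
Proof. by move=> /right_mulP[]. Qed.

Lemma right_mul_vec a S : M a -> M S -> right_mul a (v S) = v (S \o a).
Proof. by move=> /right_mulP[_]; apply. Qed.

Lemma right_mul_xi a : M a -> right_mul a xi = v a.
Proof. by move=> Ma; rewrite right_mul_vec//; exact: vn_id. Qed.

Lemma right_mul_adjoint a a' : M a -> M a' -> adjoint a a' ->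
  adjoint (right_mul a) (right_mul a').
Proof.
move=> Ma Ma' aa.
apply: (adjoint_dense _ _ dD); [exact: right_mul_bounded|exact: right_mul_bounded|].
move=> _ _ [T MT <-] [U MU <-]; have [U' MU' UU] := vn_adj vnM MU.
rewrite !right_mul_vec// (L2_vec_dot E _ MU UU); last exact: vn_comp.
rewrite (L2_vec_dot E MT (vn_comp vnM MU Ma') (adjoint_comp UU (adjoint_sym aa))).
rewrite compA (tr_comm trM (vn_comp vnM MU' MT) Ma).
by rewrite compA.
Qed.

Lemma right_mul_mulC a S : M a -> M S -> L S \o right_mul a = right_mul a \o L S.
Proof.
move=> Ma MS; have bS := L2_mul_bound MS; have ba := right_mul_bounded Ma.
apply: (eq_dense (bounded_op_comp bS ba) (bounded_op_comp ba bS) dD).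
move=> _ [U MU <-]; rewrite /= right_mul_vec// !L2_mul_vec//; last exact: vn_comp.
by rewrite right_mul_vec//; exact: vn_comp.
Qed.

(** Faithfulness of the trace: the vector [xi] separates [M]. *)
Lemma L2_vec_inj S : M S -> v S = 0 -> S = 0.
Proof.
move=> MS S0; have [S' MS' SS] := vn_adj vnM MS.
apply: (tr_faithful trM MS SS); rewrite -(L2_vec_norm MS SS) S0 nr0 expr0n.
by rewrite rmorph0.
Qed.

End StandardForm.

Arguments right_mul {R K M tau} E a _.

Lemma closed_subspace_ker (R : realType) (H : hilbertType R) (V : normedZmodType R[i])
    (f : H -> V) (C : R) :
  (forall a x y, f x = 0 -> f y = 0 -> f (a *: x + y) = 0) ->
  (forall x y, f (x - y) = f x - f y) -> (forall x, nr (f x) <= C * nr x) ->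
  closed_subspace [set x | f x = 0].
Proof.
move=> lf fB bf; split=> //=; last by have := fB 0 0; rewrite !subrr.
apply/closed_nrP => x xP; apply: (@nr_eps _ _ _ `|C|) => e e0.
have [y fy xy] := xP e e0; rewrite -[f x]subr0 -fy -fB (le_trans (bf _))//.
by rewrite (le_trans (ler_wpM2r (nr_ge0 _) (ler_norm C)))// ler_wpM2l// ltW.
Qed.

Lemma bounded_op_adjoint (R : realType) (H : hilbertType R) (T T' : H -> H) :
  bounded_op T -> adjoint T T' -> bounded_op T'.
Proof.
move=> bT TT; have [C C0 bC] := bounded_op_bound bT; apply/bounded_opP; split.
  exact: adjoint_linear (adjoint_sym TT).
exists C => // x; have [->|x0] := eqVneq (nr (T' x)) 0; first by rewrite mulr_ge0 ?nr_ge0.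
have h : nr (T' x) ^+ 2 <= C * nr x * nr (T' x).
  rewrite nr_sqr -TT (le_trans (Re_nr _))// (le_trans (cauchy_schwarz _ _))//.
  by rewrite mulrAC ler_wpM2r ?nr_ge0.
by rewrite -(@ler_pM2r _ (nr (T' x))) ?lt_neqAle 1?eq_sym ?x0 ?nr_ge0.
Qed.

Lemma closed_subspace_eq (R : realType) (H : hilbertType R) (S T : H -> H) :
  bounded_op S -> bounded_op T -> closed_subspace [set x | S x = T x].
Proof.
move=> bS bT; have bST := bounded_op_linear (-1) bT bS.
have [lST _] := bST; have [C _ bC] := bounded_op_bound bST.
have -> : [set x | S x = T x] = [set x | (-1 *: T + S) x = 0].
  apply/seteqP; split=> x /=; rewrite !fctE scaleN1r addrC; last exact: subr0_eq.
  by move=> ->; rewrite subrr.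
apply: (closed_subspace_ker _ _ bC).
- by move=> a x y Sx Sy; rewrite lST Sx Sy scaler0 addr0.
- by move=> x y; rewrite (linear_mapB _ _ lST).
Qed.

Lemma closed_subspace_orth (R : realType) (H : hilbertType R) (y : H) :
  closed_subspace [set x | dot x y = 0].
Proof.
apply: (@closed_subspace_ker _ _ _ (fun x => dot x y) (nr y)).
- by move=> a u v u0 v0; rewrite dotDl dotZl u0 v0 mulr0 addr0.
- by move=> u v; rewrite dotBl.
- by move=> x; rewrite mulrC cauchy_schwarz.
Qed.

(** * Words in the free product *)

Section Swap.
Variables (R : realType) (E1 E2 : hilbertType R) (xi1 : E1) (xi2 : E2).

Definition swap_letter (A B : Type) (a : A + B) : B + A :=
  match a with inl x => inr x | inr y => inl y end.

Lemma swap_letterK A B : cancel (@swap_letter A B) (@swap_letter B A).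
Proof. by case. Qed.

Lemma map_swapK A B (w : seq (A + B)) :
  map (@swap_letter B A) (map (@swap_letter A B) w) = w.
Proof. exact: (mapK (@swap_letterK A B)). Qed.

Lemma reduced_swap (w : seq (E2 + E1)) :
  reduced xi1 xi2 (map (@swap_letter _ _) w) = reduced xi2 xi1 w.
Proof.
rewrite /reduced all_map sorted_map; congr andb.
  by apply: eq_all => -[].
by apply: eq_sorted => -[a|a] [b|b].
Qed.

Lemma reduced_off_left_swap (w : seq (E2 + E1)) :
  reduced_off_left xi1 xi2 (map (@swap_letter _ _) w) = reduced_off_right xi2 xi1 w.
Proof. by rewrite /reduced_off_left reduced_swap; case: w => [|[]]. Qed.

Lemma reduced_off_right_swap (w : seq (E2 + E1)) :
  reduced_off_right xi1 xi2 (map (@swap_letter _ _) w) = reduced_off_left xi2 xi1 w.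
Proof. by rewrite /reduced_off_right reduced_swap; case: w => [|[]]. Qed.

Lemma word_dot_swap (u v : seq (E2 + E1)) :
  word_dot (map (@swap_letter _ _) u) (map (@swap_letter _ _) v) = word_dot u v.
Proof. by elim: u v => [|a u IH] [|b v] //=; rewrite IH; case: a b => [a|a] [b|b]. Qed.

Variable F : free_product xi1 xi2.

(* Carries every lemma about the first factor over to the second one. *)
Definition free_product_swap : free_product xi2 xi1.
Proof.
apply: (@Build_free_product _ _ _ _ _ F (fun w => fp_word F (map (@swap_letter _ _) w))
  (fp_rep2 F) (fp_rep1 F)).
- by move=> u v ru rv; rewrite fp_word_dot ?word_dot_swap// reduced_swap.
- move=> W cW WP; apply: (fp_word_total cW) => w rw.
  rewrite -(map_swapK w); apply: WP.
  by rewrite -reduced_swap map_swapK.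
- exact: fp_rep2_bounded.
- exact: fp_rep1_bounded.
- by move=> T h w bT rw; apply: fp_rep2_V => //; rewrite reduced_off_right_swap.
- by move=> T h w bT rw; apply: fp_rep1_V => //; rewrite reduced_off_left_swap.
Defined.

End Swap.

Section Words.
Variables (R : realType) (E1 E2 : hilbertType R) (xi1 : E1) (xi2 : E2).
Hypotheses (xi1_unit : dot xi1 xi1 = 1) (xi2_unit : dot xi2 xi2 = 1).
Variable F : free_product xi1 xi2.
Local Notation word := (fp_word F).
Local Notation V1 := (fp_V1 F).
Local Notation off1 := (reduced_off_left xi1 xi2).
Local Notation off2 := (reduced_off_right xi1 xi2).
Local Notation red := (reduced xi1 xi2).
Local Notation "h ^o1" := (h - dot h xi1 *: xi1) (at level 2).

Lemma fp_ext (x y : F) : (forall w, red w -> dot x (word w) = dot y (word w)) -> x = y.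
Proof.
move=> xy; apply/subr0_eq/dot_eq0.
suff : [set z | dot z (x - y) = 0] (x - y) by [].
rewrite (fp_word_total (closed_subspace_orth (x - y)))// => w rw /=.
by rewrite dotC dotBl xy// subrr rmorph0.
Qed.

Lemma fp_eq_op (S T : F -> F) : bounded_op S -> bounded_op T ->
  (forall w, red w -> S (word w) = T (word w)) -> S = T.
Proof.
move=> bS bT ST; apply/funext => x.
suff : [set z | S z = T z] x by [].
by rewrite (fp_word_total (closed_subspace_eq bS bT)).
Qed.

Lemma reduced_inl h w : red (inl h :: w) = (dot h xi1 == 0) && off1 w.
Proof.
rewrite /reduced_off_left /reduced /=; case: w => [|[a|a] w] //=; rewrite ?andbT ?andbF//.
by rewrite -!andbA.
Qed.

Lemma reduced_inr h w : red (inr h :: w) = (dot h xi2 == 0) && off2 w.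
Proof.
rewrite /reduced_off_right /reduced /=; case: w => [|[a|a] w] //=; rewrite ?andbT ?andbF//.
by rewrite -!andbA.
Qed.

Lemma off1_red w : off1 w -> red w. Proof. by case/andP. Qed.

Lemma centred1 h : dot (h^o1) xi1 = 0.
Proof. by rewrite dotBl dotZl xi1_unit mulr1 subrr. Qed.

Lemma red_V1 h w : off1 w -> red (inl (h^o1) :: w).
Proof. by rewrite reduced_inl centred1 eqxx. Qed.

Lemma word_dot_off1 h w v : off1 w -> word_dot w (inl h :: v) = 0.
Proof. by case: w => [//|[a|a] w]; rewrite /reduced_off_left ?andbF//= mul0r. Qed.

Lemma word_dotC (u v : seq (E1 + E2)) : word_dot u v = (word_dot v u)^*.
Proof.
elim: u v => [|a u IH] [|b v] /=; rewrite ?rmorph0 ?rmorph1//.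
by rewrite rmorphM IH; congr (_ * _); case: a b => [a|a] [b|b] /=; rewrite ?rmorph0// dotC.
Qed.

(** The map h (x) w |-> [V1 h w] is isometric: the part of [h] along [xi1] gives a word that does
    not begin on the left, the centred part a word that does, and the two kinds are orthogonal. *)
Lemma dot_V1 h g w v : off1 w -> off1 v -> dot (V1 h w) (V1 g v) = dot h g * word_dot w v.
Proof.
move=> ow ov; rewrite /fp_V1 !dotDl !dotDr !dotZl !dotZr.
rewrite !fp_word_dot ?red_V1 ?off1_red// (word_dot_off1 _ _ ow).
rewrite (word_dotC (_ :: _) v) (word_dot_off1 _ _ ov) rmorph0 !mulr0 addr0 add0r /=.
rewrite mulrA -mulrDl; congr (_ * _).
rewrite dotBl !dotBr !dotZl !dotZr xi1_unit [dot xi1 g]dotC.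
ring.
Qed.

Lemma word_inl0 w : off1 w -> word (inl 0 :: w) = 0.
Proof.
move=> ow; apply: dot_eq0; rewrite fp_word_dot ?reduced_inl ?dot0l ?eqxx//=.
by rewrite dot0l mul0r.
Qed.

Lemma V1_xi w : off1 w -> V1 xi1 w = word w.
Proof. by move=> ow; rewrite /fp_V1 xi1_unit !scale1r subrr word_inl0// addr0. Qed.

Lemma V1_centred h w : dot h xi1 = 0 -> V1 h w = word (inl h :: w).
Proof. by move=> h0; rewrite /fp_V1 h0 !scale0r subr0 add0r. Qed.

(** A word that does not begin with a left letter is read as xi1 (x) w, so the vectors [V1 h w]
    exhaust all reduced words. *)
Lemma left_decomposition w : red w -> exists h w1, off1 w1 /\ word w = V1 h w1.
Proof.
case: w => [|[h|h] w] rw.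
- by exists xi1, [::]; rewrite V1_xi.
- by move: rw; rewrite reduced_inl => /andP[/eqP h0 ow]; exists h, w; rewrite V1_centred.
- have ow : off1 (inr h :: w) by rewrite /reduced_off_left rw.
  by exists xi1, (inr h :: w); rewrite V1_xi.
Qed.

Lemma fp_ext1 (x y : F) :
  (forall h w, off1 w -> dot x (V1 h w) = dot y (V1 h w)) -> x = y.
Proof. by move=> xy; apply: fp_ext => w /left_decomposition[h [v [/xy + ->]]]. Qed.

Lemma fp_eq_op1 (S T : F -> F) : bounded_op S -> bounded_op T ->
  (forall h w, off1 w -> S (V1 h w) = T (V1 h w)) -> S = T.
Proof.
move=> bS bT ST; apply: fp_eq_op => // w.
by move=> /left_decomposition[h [v [/ST + ->]]].
Qed.

(** Linearity of [fp_word] in a letter is deduced, not postulated: the inner products with a total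
    family are linear in [h] by [dot_V1]. *)
Lemma V1_linear a h g w : off1 w -> V1 (a *: h + g) w = a *: V1 h w + V1 g w.
Proof.
move=> ow; apply: fp_ext1 => k v ov; rewrite [RHS]dotDl [X in _ = X + _]dotZl.
by rewrite !dot_V1// dotDl dotZl mulrDl mulrA.
Qed.

Lemma nr_V1 h w : off1 w -> nr (V1 h w) = nr h * nr (word w).
Proof.
move=> ow; apply/eqP; rewrite -(@eqrXn2 _ 2)// ?mulr_ge0 ?nr_ge0//; apply/eqP/complexI.
rewrite exprMn [RHS]rmorphM/= -!dotx dot_V1// fp_word_dot//; exact: off1_red.
Qed.

Section Rep1.
Implicit Types S T : E1 -> E1.

Lemma rep1_linear a S T : bounded_op S -> bounded_op T ->
  fp_rep1 F (a *: S + T) = a *: fp_rep1 F S + fp_rep1 F T.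
Proof.
move=> bS bT; have bST := bounded_op_linear a bS bT.
have bFS := fp_rep1_bounded F bS; have bFT := fp_rep1_bounded F bT.
apply: fp_eq_op1; [exact: fp_rep1_bounded|exact: bounded_op_linear|].
by move=> h w ow; rewrite fp_rep1_V// V1_linear// -!fp_rep1_V.
Qed.

Lemma rep1_comp S T : bounded_op S -> bounded_op T ->
  fp_rep1 F (S \o T) = fp_rep1 F S \o fp_rep1 F T.
Proof.
move=> bS bT; have bST := bounded_op_comp bS bT.
have bFS := fp_rep1_bounded F bS; have bFT := fp_rep1_bounded F bT.
apply: fp_eq_op1; [exact: fp_rep1_bounded|exact: bounded_op_comp|].
by move=> h w ow; rewrite /= !fp_rep1_V.
Qed.

Lemma rep1_id : fp_rep1 F id = id.
Proof.
have b1 := @bounded_op_id R E1.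
apply: fp_eq_op1; [exact: fp_rep1_bounded|exact: bounded_op_id|].
by move=> h w ow; rewrite fp_rep1_V.
Qed.

(** The bounded operator [fp_rep1 F S] has some adjoint; [dot_V1] identifies it with [fp_rep1 F T]
    on the total family. *)
Lemma rep1_adjoint S T : bounded_op S -> bounded_op T -> adjoint S T ->
  adjoint (fp_rep1 F S) (fp_rep1 F T).
Proof.
move=> bS bT ST.
have bFS := fp_rep1_bounded F bS; have bFT := fp_rep1_bounded F bT.
have [S' SS'] := adjoint_exists bFS.
have bS' := bounded_op_adjoint bFS SS'.
suff -> : fp_rep1 F T = S' by [].
apply: fp_eq_op1 => // g v ov; apply: fp_ext1 => h w ow.
rewrite [RHS]dotC -SS' -dotC !fp_rep1_V// !dot_V1//.
by rewrite [in RHS]dotC ST -dotC.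
Qed.
End Rep1.

End Words.

Lemma closed_subspace_closure (R : realType) (H : hilbertType R) (D : set H) :
  D 0 -> (forall a x y, D x -> D y -> D (a *: x + y)) ->
  closed_subspace [set x | forall e : R, 0 < e -> exists2 y, D y & nr (x - y) < e].
Proof.
move=> D0 DL; split=> [|e e0|a x y xD yD e e0].
- apply/closed_nrP => x xP e e0.
  have [|y yP xy] := xP (e / 2); first by rewrite divr_gt0.
  have [|z Dz yz] := yP (e / 2); first by rewrite divr_gt0.
  exists z => //; rewrite -(subrKA y).
  by have := nrD (x - y) (y - z); lra.
- by exists 0 => //; rewrite subrr nr0.
have a1 : 0 < nr a + 1 by rewrite ltr_wpDl ?nr_ge0.
have [|x' Dx' xx'] := xD (e / 2 / (nr a + 1)); first by rewrite !divr_gt0.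
have [|y' Dy' yy'] := yD (e / 2); first by rewrite divr_gt0.
exists (a *: x' + y'); first exact: DL.
rewrite opprD addrACA -scalerBr (le_lt_trans (nrD _ _))// nrZ.
move: xx'; rewrite ltr_pdivlMr// => xx'.
by have := nr_ge0 (x - x'); nra.
Qed.

(** * The flip of words, and commutation of left and right actions *)

Section Flip.
Variables (R : realType) (E1 E2 : hilbertType R) (xi1 : E1) (xi2 : E2).
Variable F : free_product xi1 xi2.
Local Notation word := (fp_word F).
Local Notation red := (reduced xi1 xi2).

Lemma reduced_rev w : red (rev w) = red w.
Proof.
rewrite /reduced all_rev rev_sorted; congr andb; apply: eq_sorted => a b.
by rewrite eq_sym.
Qed.

Lemma word_dot_cat (u u' v v' : seq (E1 + E2)) : size u = size v ->
  word_dot (u ++ u') (v ++ v') = word_dot u v * word_dot u' v'.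
Proof.
elim: u v => [|a u IH] [|b v] //=; first by rewrite mul1r.
by move=> [uv]; rewrite IH// mulrA.
Qed.

Lemma word_dot_size (u v : seq (E1 + E2)) : size u != size v -> word_dot u v = 0.
Proof. by elim: u v => [|a u IH] [|b v] //= /IH ->; rewrite mulr0. Qed.

Lemma word_dot_rev (u v : seq (E1 + E2)) : word_dot (rev u) (rev v) = word_dot u v.
Proof.
have [|uv] := eqVneq (size u) (size v); last by rewrite !word_dot_size ?size_rev.
elim: u v => [|a u IH] [|b v] //= [uv]; rewrite !rev_cons -!cats1 word_dot_cat ?size_rev//.
by rewrite IH//= mulr1 mulrC.
Qed.

(* The flip conjugates the left actions into the right ones. *)
Record is_flip (Sg : F -> F) : Prop := {
  flip_bounded : bounded_op Sg ;
  flip_adjoint : adjoint Sg Sg ;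
  flipK : involutive Sg ;
  flip_word : forall w, red w -> Sg (word w) = word (rev w) }.

(** Reversal keeps the inner products of words, so matching a linear combination of words with its
    reversal is isometric. It is a relation because one vector may have several such expressions. *)
Lemma flip_exists : exists Sg, is_flip Sg.
Proof.
pose comb (f : seq (E1 + E2) -> seq (E1 + E2)) (s : seq (R[i] * seq (E1 + E2))) : F :=
  \sum_(p <- s) p.1 *: word (f p.2).
pose G x y := exists2 s, all (fun p => red p.2) s & x = comb id s /\ y = comb rev s.
have lG a x x' y y' : G x y -> G x' y' -> G (a *: x + x') (a *: y + y').
  move=> [s rs [-> ->]] [s' rs' [-> ->]].
  exists ([seq (a * p.1, p.2) | p <- s] ++ s'); first by rewrite all_cat all_map; apply/andP.
  by rewrite /comb !big_cat !big_map/= !scaler_sumr; split; congr (_ + _);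
    apply: eq_bigr => p _; rewrite scalerA.
have G0 : G 0 0 by exists [::] => //; rewrite /comb !big_nil.
have nG x y : G x y -> nr y = nr x.
  move=> [s rs [-> ->]]; apply/eqP; rewrite -(@eqrXn2 _ 2)// ?nr_ge0//; apply/eqP.
  rewrite !nr_sqr; congr complex.Re; rewrite /comb !dot_suml.
  apply: eq_big_seq => p /(allP rs) rp; rewrite !dot_sumr.
  apply: eq_big_seq => q /(allP rs) rq; rewrite !dotZl !dotZr.
  by rewrite !fp_word_dot ?reduced_rev// word_dot_rev.
have GC x y : G x y -> G y x.
  move=> [s rs [-> ->]]; exists [seq (p.1, rev p.2) | p <- s].
    by rewrite all_map; apply: sub_all rs => p /=; rewrite reduced_rev.
  rewrite /comb !big_map; split=> //.
  by apply: eq_bigr => p _ /=; rewrite revK.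
have Gw w : red w -> G (word w) (word (rev w)).
  move=> rw; exists [:: (1, w)]; rewrite /= ?rw//.
  by rewrite /comb !big_seq1 !scale1r.
have dG x (e : R) : 0 < e -> exists x' y', G x' y' /\ nr (x - x') < e.
  pose D := [set x | exists y, G x y].
  pose W := [set x | forall e : R, 0 < e -> exists2 y, D y & nr (x - y) < e].
  suff WT : W = setT.
    have : W x by rewrite WT.
    by move=> h /h[x' [y' g] xx']; exists x', y'.
  apply: (@fp_word_total _ _ _ _ _ F).
    apply: closed_subspace_closure; first by exists 0.
    by move=> a u v [u' gu] [v' gv]; exists (a *: u' + v'); exact: lG.
  move=> w rw e' e'0; exists (word w); last by rewrite subrr nr0.
  by exists (word (rev w)); exact: Gw.
have dG' y (e : R) : 0 < e -> exists x' y', G x' y' /\ nr (y - y') < e.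
  by move=> /(dG y)[x' [y' [/GC g xx']]]; exists y', x'.
have [U [U' [lU lU' UK U'K [nU _ UG]]]] := unitary_relation lG nG dG dG'.
have bU : bounded_op U.
  by apply/bounded_opP; split=> //; exists 1 => // x; rewrite mul1r nU.
have Uw w : red w -> U (word w) = word (rev w) by move=> /Gw /UG.
have UU : involutive U.
  have : U \o U = id.
    apply: fp_eq_op; [exact: bounded_op_comp|exact: bounded_op_id|].
    by move=> w rw; rewrite /= !Uw ?reduced_rev// revK.
  by move=> UU x; move/(congr1 (@^~ x)): UU.
exists U; split=> // x y.
by rewrite -{1}(UU y) isometry_dot.
Qed.

End Flip.

Lemma flip_swap (R : realType) (E1 E2 : hilbertType R) (xi1 : E1) (xi2 : E2)
  (F : free_product xi1 xi2) (Sg : F -> F) :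
  is_flip Sg -> @is_flip _ _ _ _ _ (free_product_swap F) Sg.
Proof.
move=> [bS aS SK Sw]; split=> // w rw.
by rewrite /= Sw ?reduced_swap// map_rev.
Qed.

Section Commutation.
Variables (R : realType) (E1 E2 : hilbertType R) (xi1 : E1) (xi2 : E2).
Hypotheses (xi1_unit : dot xi1 xi1 = 1) (xi2_unit : dot xi2 xi2 = 1).
Variable F : free_product xi1 xi2.
Variable Sg : F -> F.
Hypothesis flipS : is_flip Sg.
Local Notation word := (fp_word F).
Local Notation V1 := (fp_V1 F).
Local Notation V2 := (fp_V2 F).
Local Notation off1 := (reduced_off_left xi1 xi2).
Local Notation off2 := (reduced_off_right xi1 xi2).
Local Notation red := (reduced xi1 xi2).
Local Notation "h ^o1" := (h - dot h xi1 *: xi1) (at level 2).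
Local Notation "h ^o2" := (h - dot h xi2 *: xi2) (at level 2).

Lemma centred2 h : dot (h^o2) xi2 = 0.
Proof. by rewrite dotBl dotZl xi2_unit mulr1 subrr. Qed.

Lemma V2_swap h w : V2 h w = fp_V1 (free_product_swap F) h (map (@swap_letter _ _) w).
Proof. by rewrite /fp_V2 /fp_V1 /= map_swapK. Qed.

Lemma off2_swap w : off2 w -> reduced_off_left xi2 xi1 (map (@swap_letter _ _) w).
Proof. by rewrite reduced_off_left_swap. Qed.

Lemma V2_xi w : off2 w -> V2 xi2 w = word w.
Proof.
move=> ow; rewrite V2_swap (V1_xi xi2_unit)/= ?map_swapK//.
exact: off2_swap.
Qed.

Lemma V2_centred h w : dot h xi2 = 0 -> V2 h w = word (inr h :: w).
Proof. by move=> h0; rewrite /fp_V2 h0 !scale0r subr0 add0r. Qed.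

Lemma red_V2 h w : off2 w -> red (inr (h^o2) :: w).
Proof. by rewrite reduced_inr centred2 eqxx. Qed.

Definition right_V1 (w : seq (E1 + E2)) (g : E1) : F :=
  dot g xi1 *: word w + word (rcons w (inl (g^o1))).
Definition right_V2 (w : seq (E1 + E2)) (g : E2) : F :=
  dot g xi2 *: word w + word (rcons w (inr (g^o2))).

Lemma right_V1E w g : off1 (rev w) -> right_V1 w g = Sg (V1 g (rev w)).
Proof.
move=> ow; rewrite /fp_V1 (bounded_op_lin (flip_bounded flipS)).
rewrite !(flip_word flipS) ?red_V1 ?(off1_red ow)//.
by rewrite rev_cons !revK.
Qed.

Lemma right_V2E w g : off2 (rev w) -> right_V2 w g = Sg (V2 g (rev w)).
Proof.
move=> ow; rewrite /fp_V2 (bounded_op_lin (flip_bounded flipS)).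
rewrite !(flip_word flipS) ?red_V2//; last by case/andP: ow.
by rewrite rev_cons !revK.
Qed.

(** The flip is linear, unlike the modular conjugation, so this conjugation moves an operator from
    the first tensor leg to the last one as it is, without passing to the adjoint. *)
Definition rho1 (T : E1 -> E1) : F -> F := Sg \o fp_rep1 F T \o Sg.
Definition rho2 (T : E2 -> E2) : F -> F := Sg \o fp_rep2 F T \o Sg.

Lemma rho1_bounded T : bounded_op T -> bounded_op (rho1 T).
Proof.
move=> bT; have bS := flip_bounded flipS.
by do 2!apply: bounded_op_comp => //; exact: fp_rep1_bounded.
Qed.

Lemma rho2_bounded T : bounded_op T -> bounded_op (rho2 T).
Proof.
move=> bT; have bS := flip_bounded flipS.
by do 2!apply: bounded_op_comp => //; exact: fp_rep2_bounded.
Qed.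

Lemma rho1_V T w g : bounded_op T -> off1 (rev w) ->
  rho1 T (right_V1 w g) = right_V1 w (T g).
Proof.
by move=> bT ow; rewrite /rho1 /= !right_V1E// (flipK flipS) fp_rep1_V.
Qed.

Lemma rho2_V T w g : bounded_op T -> off2 (rev w) ->
  rho2 T (right_V2 w g) = right_V2 w (T g).
Proof.
by move=> bT ow; rewrite /rho2 /= !right_V2E// (flipK flipS) fp_rep2_V.
Qed.

Lemma rho1_adjoint T T' : bounded_op T -> bounded_op T' -> adjoint T T' ->
  adjoint (rho1 T) (rho1 T').
Proof.
move=> bT bT' TT; have aS := flip_adjoint flipS.
exact: adjoint_comp (adjoint_comp aS (rep1_adjoint xi1_unit bT bT' TT)) aS.
Qed.

(* [V12 h c g] and [V11 h c g] are h (x) c (x) g, where h and g need not be centred: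
   the left action moves h and the right action moves g. *)
Definition V12 h c g := dot g xi2 *: V1 h c + V1 h (rcons c (inr (g^o2))).
Definition V11 h c g := dot g xi1 *: V1 h c + V1 h (rcons c (inl (g^o1))).

(** Expanding the first leg or the last leg first yields the same four terms. The definition
    isolates the first leg, as [fp_rep1] requires; this form isolates the last one for [rho2]. *)
Lemma V12E h c g : V12 h c g = dot h xi1 *: right_V2 c g + right_V2 (inl (h^o1) :: c) g.
Proof.
rewrite /V12 /fp_V1 /right_V2 !scalerDr !scalerA -!addrA; congr (_ + _).
  by rewrite mulrC.
by rewrite addrCA.
Qed.

Lemma V11E h c g : V11 h c g = dot h xi1 *: right_V1 c g + right_V1 (inl (h^o1) :: c) g.
Proof.
rewrite /V11 /fp_V1 /right_V1 !scalerDr !scalerA -!addrA; congr (_ + _).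
  by rewrite mulrC.
by rewrite addrCA.
Qed.

Lemma off1_rcons_inr c g : off1 c -> off2 (rev c) -> dot g xi2 = 0 ->
  off1 (rcons c (inr g)).
Proof.
move=> oc oc' g0; have : red (inr g :: rev c) by rewrite reduced_inr g0 eqxx.
rewrite -reduced_rev rev_cons revK /reduced_off_left => ->.
by case: c oc {oc'} => //= a c /andP[].
Qed.

Lemma off2_rev_cons c h : off1 c -> off2 (rev c) -> dot h xi1 = 0 ->
  off2 (rev (inl h :: c)).
Proof.
move=> oc oc' h0; rewrite /reduced_off_right reduced_rev reduced_inl h0 eqxx oc /=.
rewrite rev_cons; case/andP: oc' => _.
by case: (rev c).
Qed.

Lemma off1_rcons_inl c g : c != [::] -> off1 c -> off1 (rev c) -> dot g xi1 = 0 ->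
  off1 (rcons c (inl g)).
Proof.
move=> c0 oc oc' g0; have : red (inl g :: rev c) by rewrite reduced_inl g0 eqxx.
rewrite -reduced_rev rev_cons revK /reduced_off_left => ->.
by case: c c0 oc {oc'} => //= a c _ /andP[].
Qed.

Lemma off1_rev_cons c h : c != [::] -> off1 c -> off1 (rev c) -> dot h xi1 = 0 ->
  off1 (rev (inl h :: c)).
Proof.
move=> c0 oc oc' h0; rewrite /reduced_off_left reduced_rev reduced_inl h0 eqxx oc /=.
rewrite rev_cons; case/andP: oc' => _.
have : rev c != [::] by rewrite -size_eq0 size_rev size_eq0.
by case: (rev c).
Qed.

Lemma rep1_V12 T h c g : bounded_op T -> off1 c -> off2 (rev c) ->
  fp_rep1 F T (V12 h c g) = V12 (T h) c g.
Proof.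
move=> bT oc oc'; rewrite /V12 (bounded_op_lin (fp_rep1_bounded F bT)).
by rewrite !fp_rep1_V// off1_rcons_inr// centred2.
Qed.

Lemma rho2_V12 T h c g : bounded_op T -> off1 c -> off2 (rev c) ->
  rho2 T (V12 h c g) = V12 h c (T g).
Proof.
move=> bT oc oc'; rewrite !V12E (bounded_op_lin (rho2_bounded bT)).
by rewrite !rho2_V// off2_rev_cons// centred1.
Qed.

Lemma rep1_V11 T h c g : bounded_op T -> c != [::] -> off1 c -> off1 (rev c) ->
  fp_rep1 F T (V11 h c g) = V11 (T h) c g.
Proof.
move=> bT c0 oc oc'; rewrite /V11 (bounded_op_lin (fp_rep1_bounded F bT)).
by rewrite !fp_rep1_V// off1_rcons_inl// centred1.
Qed.

Lemma rho1_V11 T h c g : bounded_op T -> c != [::] -> off1 c -> off1 (rev c) ->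
  rho1 T (V11 h c g) = V11 h c (T g).
Proof.
move=> bT c0 oc oc'; rewrite !V11E (bounded_op_lin (rho1_bounded bT)).
by rewrite !rho1_V// off1_rev_cons// centred1.
Qed.

Lemma right_V1_nil g : right_V1 [::] g = V1 g [::].
Proof. by []. Qed.

Lemma V12_xi h c : off1 c -> off2 (rev c) -> V12 h c xi2 = V1 h c.
Proof.
move=> oc oc'; rewrite V12E.
rewrite !right_V2E ?off2_rev_cons ?centred1//.
rewrite !V2_xi ?off2_rev_cons ?centred1//.
rewrite !(flip_word flipS) ?reduced_rev ?red_V1 ?(off1_red oc)// !revK//.
Qed.

Lemma V11_xi h c : c != [::] -> off1 c -> off1 (rev c) -> V11 h c xi1 = V1 h c.
Proof.
move=> c0 oc oc'; rewrite V11E.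
rewrite !right_V1E ?off1_rev_cons ?centred1//.
rewrite !V1_xi ?off1_rev_cons ?centred1//.
rewrite !(flip_word flipS) ?reduced_rev ?red_V1 ?(off1_red oc)// !revK//.
Qed.

(** If [w] ends with a right letter, that letter is the leg [g]; otherwise [w] is entirely the
    middle part and the last leg is [xi2]. *)
Lemma V12_decomposition w : off1 w -> exists c g,
  [/\ off1 c, off2 (rev c) & forall h, V1 h w = V12 h c g].
Proof.
case/lastP: w => [|c [g|g]] ow.
- by exists [::], xi2; split=> // h; rewrite V12_xi.
- have oc' : off2 (rev (rcons c (inl g))).
    by rewrite /reduced_off_right reduced_rev (off1_red ow) rev_rcons.
  by exists (rcons c (inl g)), xi2; split=> // h; rewrite V12_xi.
have : red (inr g :: rev c) by rewrite -rev_rcons reduced_rev off1_red.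
rewrite reduced_inr => /andP[/eqP g0 oc'].
exists c, g; split=> //.
  rewrite /reduced_off_left -reduced_rev; case/andP: oc' => -> _ /=.
  by case: c ow => //= a c /andP[_ ->].
by move=> h; rewrite /V12 g0 !scale0r subr0 add0r.
Qed.

(** As [w] does not begin on the left, removing a final left letter leaves a nonempty middle part.
    For empty [w] the two legs would be adjacent letters of the same factor and would merge into
    one. *)
Lemma V11_decomposition w : off1 w -> w != [::] -> exists c g,
  [/\ c != [::], off1 c, off1 (rev c) & forall h, V1 h w = V11 h c g].
Proof.
case/lastP: w => [//|c [g|g]] ow _; last first.
  have oc' : off1 (rev (rcons c (inr g))).
    by rewrite /reduced_off_left reduced_rev (off1_red ow) rev_rcons.
  have c0 : rcons c (inr g) != [::] by case: c {ow oc'}.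
  by exists (rcons c (inr g)), xi1; split=> // h; rewrite V11_xi.
have : red (inl g :: rev c) by rewrite -rev_rcons reduced_rev off1_red.
rewrite reduced_inl => /andP[/eqP g0 oc'].
have c0 : c != [::] by case: c ow {oc'} => //; rewrite /reduced_off_left andbF.
exists c, g; split=> //.
  rewrite /reduced_off_left -reduced_rev; case/andP: oc' => -> _ /=.
  by case: c ow {c0} => //= a c /andP[_ ->].
by move=> h; rewrite /V11 g0 !scale0r subr0 add0r.
Qed.

Lemma rep1_rho2 T T' : bounded_op T -> bounded_op T' ->
  fp_rep1 F T \o rho2 T' = rho2 T' \o fp_rep1 F T.
Proof.
move=> bT bT'; have b1 := fp_rep1_bounded F bT; have b2 := rho2_bounded bT'.
apply: fp_eq_op1 => //; [exact: bounded_op_comp|exact: bounded_op_comp|].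
move=> h w /V12_decomposition[c [g [oc oc' ->]]] /=.
by rewrite rho2_V12// !rep1_V12// rho2_V12.
Qed.

(** For nonempty [w] the two operators act on separate legs. On the copy of [E1], where [w] is
    empty, they act on the same leg, and there they commute by assumption. *)
Lemma rep1_rho1 T T' : bounded_op T -> bounded_op T' -> T \o T' = T' \o T ->
  fp_rep1 F T \o rho1 T' = rho1 T' \o fp_rep1 F T.
Proof.
move=> bT bT' TT; have b1 := fp_rep1_bounded F bT; have b2 := rho1_bounded bT'.
apply: fp_eq_op1 => //; [exact: bounded_op_comp|exact: bounded_op_comp|].
move=> h w ow /=; have [->|w0] := eqVneq w [::].
  rewrite -right_V1_nil rho1_V// !right_V1_nil !fp_rep1_V//.
  rewrite -!right_V1_nil rho1_V//.
  by move/(congr1 (@^~ h)): TT => /= ->.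
have [c [g [c0 oc oc' ->]]] := V11_decomposition ow w0.
by rewrite rho1_V11// !rep1_V11// rho1_V11.
Qed.

Lemma rep2_rho1 T T' : bounded_op T -> bounded_op T' ->
  fp_rep2 F T \o rho1 T' = rho1 T' \o fp_rep2 F T.
Proof.
move=> bT bT'; apply/funext => x /=.
(* Conjugation by the flip exchanges the left and right actions, which turns the commutation of
   [rep1_rho2] into the present one. *)
have /(congr1 (@^~ (Sg x)))/= := rep1_rho2 bT' bT.
by rewrite /rho1 /rho2 /= !(flipK flipS) => ->; rewrite (flipK flipS).
Qed.

(** The parts of [g] along [xi1] and orthogonal to it give words of different lengths, so the cross
    terms vanish and each leg contributes its own factor. *)
Lemma dot_V11 h h' c g g' : c != [::] -> off1 c -> off1 (rev c) ->
  dot (V11 h c g) (V11 h' c g') = dot h h' * dot g g' * word_dot c c.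
Proof.
move=> c0 oc oc'.
have oc1 := off1_rcons_inl c0 oc oc' (centred1 xi1_unit g).
have oc2 := off1_rcons_inl c0 oc oc' (centred1 xi1_unit g').
have h11 := dot_V1 xi1_unit F h h' oc oc; have h12 := dot_V1 xi1_unit F h h' oc oc2.
have h21 := dot_V1 xi1_unit F h h' oc1 oc; have h22 := dot_V1 xi1_unit F h h' oc1 oc2.
rewrite word_dot_size ?size_rcons ?neq_ltn ?leqnn// mulr0 in h12.
rewrite word_dot_size ?size_rcons ?neq_ltn ?leqnn ?orbT// mulr0 in h21.
rewrite -!cats1 word_dot_cat//= mulr1 !cats1 in h22.
rewrite /V11; move: (V1 h (rcons _ _)) (V1 h c) h11 h12 h21 h22 => B A.
move: (V1 h' (rcons _ _)) (V1 h' c) => B' A' h11 h12 h21 h22.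
rewrite !dotDl !dotDr !dotZl !dotZr h11 h12 h21 h22 !mulr0 addr0 add0r.
have -> : dot g g' = (dot g' xi1)^* * dot g xi1 + dot (g^o1) (g'^o1).
  by rewrite !dotBl !dotBr !dotZl !dotZr xi1_unit [dot xi1 g']dotC; ring.
ring.
Qed.

Lemma nr_V11 h c g : c != [::] -> off1 c -> off1 (rev c) ->
  nr (V11 h c g) = nr h * nr g * nr (word c).
Proof.
move=> c0 oc oc'; apply/eqP; rewrite -(@eqrXn2 _ 2)// ?mulr_ge0 ?nr_ge0//.
apply/eqP/complexI; rewrite !exprMn [RHS]rmorphM [X in _ = X * _]rmorphM/= -!dotx.
by rewrite dot_V11// fp_word_dot// off1_red.
Qed.

Lemma V11_linear_left a h h' c g : c != [::] -> off1 c -> off1 (rev c) ->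
  V11 (a *: h + h') c g = a *: V11 h c g + V11 h' c g.
Proof.
move=> c0 oc oc'; have oc1 := off1_rcons_inl c0 oc oc' (centred1 xi1_unit g).
rewrite /V11 !V1_linear// !scalerDr !scalerA addrACA; congr (_ + _ + _).
by rewrite [dot g xi1 * a]mulrC mulrA.
Qed.

Lemma V11_linear_right a h c g g' : c != [::] -> off1 c -> off1 (rev c) ->
  V11 h c (a *: g + g') = a *: V11 h c g + V11 h c g'.
Proof.
move=> c0 oc oc'; have oc1 := off1_rev_cons c0 oc oc' (centred1 xi1_unit h).
have lS := bounded_op_lin (flip_bounded flipS).
rewrite !V11E !right_V1E// !V1_linear// !lS !scalerDr !scalerA addrACA.
congr (_ + _ + _). by rewrite mulrCA mulrA [dot h xi1 * a]mulrC.
Qed.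

End Commutation.

(** * Diffuse algebras *)

Section Limits.
Variables (R : realType) (H : hilbertType R).
Implicit Types (u : nat -> H) (l x y : H).

Definition tends u l := forall e : R, 0 < e -> exists n, forall m, (n <= m)%N -> nr (l - u m) < e.

Lemma tends_uniq u l l' : tends u l -> tends u l' -> l = l'.
Proof.
move=> ul ul'; apply/subr0_eq/(@nr_eps _ _ _ 2) => e e0.
have [n nP] := ul _ e0; have [n' n'P] := ul' _ e0.
pose m := maxn n n'; have := nP m (leq_maxl _ _); have := n'P m (leq_maxr _ _).
rewrite nrB => h' h; rewrite -(subrKA (u m)).
by have := nrD (l - u m) (u m - l'); lra.
Qed.

Lemma tends_linear a u u' l l' : tends u l -> tends u' l' ->
  tends (fun n => a *: u n + u' n) (a *: l + l').
Proof.
move=> ul ul' e e0; have a1 : 0 < nr a + 1 by rewrite ltr_wpDl ?nr_ge0.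
have [|n nP] := ul (e / 2 / (nr a + 1)); first by rewrite !divr_gt0.
have [|n' n'P] := ul' (e / 2); first by rewrite divr_gt0.
exists (maxn n n') => m; rewrite geq_max => /andP[/nP h /n'P h'].
rewrite opprD addrACA -scalerBr (le_lt_trans (nrD _ _))// nrZ.
move: h; rewrite ltr_pdivlMr// => h.
by have := nr_ge0 (l - u m); nra.
Qed.

Lemma tends_op T u l : bounded_op T -> tends u l -> tends (T \o u) (T l).
Proof.
move=> bT ul e e0; have [C C0 bC] := bounded_op_bound bT.
have [|n nP] := ul (e / (C + 1)); first by rewrite divr_gt0// ltr_wpDl.
exists n => m /nP; rewrite ltr_pdivlMr ?ltr_wpDl// => h.
rewrite /= -(linear_mapB _ _ (bounded_op_lin bT)) (le_lt_trans (bC _))//.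
by have := nr_ge0 (l - u m); lra.
Qed.

Lemma tends_shift u l n : tends u l -> tends (fun m => u (n + m)%N) l.
Proof.
move=> ul e /ul[k kP]; exists k => m km; apply: kP.
by rewrite (leq_trans km)// leq_addl.
Qed.

Lemma tends_nr_le u l (C : R) : tends u l -> (forall n, nr (u n) <= C) -> nr l <= C.
Proof.
move=> ul uC; apply/ler_addgt0Pr => e /ul[n /(_ n (leqnn _))].
by have := nrD (l - u n) (u n); rewrite subrK; have := uC n; lra.
Qed.

End Limits.

Lemma nondecreasing_cauchy (R : realType) (a : nat -> R) (C : R) :
  (forall n m, (n <= m)%N -> a n <= a m) -> (forall n, a n <= C) ->
  forall e, 0 < e -> exists n, forall m, (n <= m)%N -> a m - a n < e.
Proof.
move=> ai aC e e0; pose S := range a.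
have hS : has_sup S by split; [exists (a 0%N), 0%N|exists C => _ [n _ <-]].
have [_ [n _ <-] nP] := sup_adherent e0 hS.
exists n => m _; have : a m <= sup S by apply: sup_ubound; [exact: hS.2|exists m].
lra.
Qed.

Section Projections.
Variables (R : realType) (H : hilbertType R).
Implicit Types (e f P Q S T : H -> H) (x y : H).

Lemma proj_bounded P : projection P -> bounded_op P. Proof. by case. Qed.
Lemma proj_lin P : projection P -> linear P. Proof. by case=> [[]]. Qed.
Lemma proj_adj P : projection P -> adjoint P P. Proof. by case. Qed.
Lemma proj_idem P x : projection P -> P (P x) = P x.
Proof. by case=> _ _ /(congr1 (@^~ x)). Qed.

Lemma proj_dot P x : projection P -> dot (P x) x = (nr (P x) ^+ 2)%:C.
Proof. by move=> pP; rewrite -dotx -[in RHS](proj_adj pP) proj_idem. Qed.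

Lemma proj_nr P x : projection P -> nr (P x) <= nr x.
Proof.
move=> pP; have [->|x0] := eqVneq (nr (P x)) 0; first exact: nr_ge0.
have : nr (P x) ^+ 2 <= nr x * nr (P x).
  rewrite nr_sqr -(proj_adj pP) proj_idem// (le_trans (Re_nr _))// mulrC.
  exact: cauchy_schwarz.
by rewrite expr2 ler_pM2r// lt_neqAle eq_sym x0 nr_ge0.
Qed.

Lemma orth_sym P Q : adjoint P P -> adjoint Q Q -> linear P -> P \o Q = 0 -> Q \o P = 0.
Proof.
move=> aP aQ lP PQ; apply/funext => x /=; apply: dot_inj => y.
rewrite aQ aP; have /(congr1 (@^~ y))/= -> := PQ.
by rewrite dot0r dot0l.
Qed.

Lemma proj_add P Q : projection P -> projection Q -> P \o Q = 0 -> projection (P + Q).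
Proof.
move=> pP pQ PQ; have QP := orth_sym (proj_adj pP) (proj_adj pQ) (proj_lin pP) PQ.
have bP := proj_bounded pP; have bQ := proj_bounded pQ.
split.
- by rewrite -[P](scale1r (P : H -> H)); exact: bounded_op_linear.
- by move=> x y; rewrite /= !fctE dotDl dotDr (proj_adj pP) (proj_adj pQ).
apply/funext => x; rewrite /= !fctE (linear_mapD _ _ (proj_lin pP)).
rewrite (linear_mapD _ _ (proj_lin pQ)) !proj_idem//.
have /(congr1 (@^~ x))/= -> := PQ; have /(congr1 (@^~ x))/= -> := QP.
by rewrite addr0 add0r.
Qed.

Lemma proj_sub P Q : projection P -> projection Q -> P \o Q = Q -> projection (P - Q).
Proof.
move=> pP pQ PQ; have bP := proj_bounded pP; have bQ := proj_bounded pQ.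
have QP : Q \o P = Q.
  apply/funext => x /=; apply: dot_inj => y.
  rewrite (proj_adj pQ) (proj_adj pP).
  by have /(congr1 (@^~ y))/= -> := PQ; rewrite (proj_adj pQ).
split.
- have -> : P - Q = (-1 : R[i]) *: Q + P by rewrite scaleN1r addrC.
  exact: bounded_op_linear.
- by move=> x y; rewrite /= !fctE dotBl dotBr (proj_adj pP) (proj_adj pQ).
apply/funext => x; rewrite /= !fctE (linear_mapB _ _ (proj_lin pP)).
rewrite (linear_mapB _ _ (proj_lin pQ)) !proj_idem//.
have /(congr1 (@^~ x))/= -> := PQ; have /(congr1 (@^~ x))/= -> := QP.
by rewrite subrr subr0.
Qed.

(** The order puts the kernel of [P] inside the kernel of [Q], so [Q] kills the range of 1 - P;
    taking adjoints gives P Q = Q. *)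
Lemma proj_le P Q : projection P -> projection Q -> op_le Q P -> P \o Q = Q.
Proof.
move=> pP pQ QP.
have ker x : P x = 0 -> Q x = 0.
  move=> Px; have := QP x; rewrite !proj_dot// lecR Px nr0 expr0n => h.
  by apply/nr_eq0/eqP; rewrite -sqrf_eq0 eq_le h sqr_ge0.
apply/funext => x /=; apply: dot_inj => y.
rewrite (proj_adj pP) (proj_adj pQ) [RHS](proj_adj pQ); congr dot.
apply/subr0_eq; rewrite -(linear_mapB _ _ (proj_lin pQ)) ker//.
by rewrite (linear_mapB _ _ (proj_lin pP)) proj_idem// subrr.
Qed.

Lemma proj_id : projection (@id H).
Proof. by split=> //; exact: bounded_op_id. Qed.

Lemma proj0 : projection (0 : H -> H).
Proof.
split; [exact: bounded_op0| |by []].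
by move=> x y; rewrite dot0l dot0r.
Qed.

(** By Pythagoras, |e_n x - e_m x|^2 is an increment of the bounded nondecreasing sequence |e_n
    x|^2; hence e_n x is Cauchy, and [P] is the strong limit. *)
Lemma proj_sup (e : nat -> H -> H) : (forall n, projection (e n)) ->
  (forall n m, (n <= m)%N -> e m \o e n = e n) ->
  exists P, [/\ projection P, forall n, e n \o P = e n & forall x, tends (e^~ x) (P x)].
Proof.
move=> pe ie.
have ie' n m : (n <= m)%N -> e n \o e m = e n.
  move=> /ie h; apply/funext => x /=; apply: dot_inj => y.
  rewrite (proj_adj (pe n)) (proj_adj (pe m)).
  by have /(congr1 (@^~ y))/= -> := h; rewrite (proj_adj (pe n)).
have pyth x n m : (n <= m)%N -> nr (e n x - e m x) ^+ 2 = nr (e m x) ^+ 2 - nr (e n x) ^+ 2.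
  move=> nm; rewrite nrD_sqr nrN dotNr raddfN/=.
  suff -> : dot (e n x) (e m x) = dot (e n x) (e n x) by rewrite -nr_sqr; ring.
  rewrite (proj_adj (pe n)) [RHS](proj_adj (pe n)) proj_idem//.
  by have /(congr1 (@^~ x))/= -> := ie' _ _ nm.
have /choice[P PP] : forall x, exists l, tends (e^~ x) l.
  move=> x; apply: complete_nr => d d0.
  have [|||n nP] := @nondecreasing_cauchy _ (fun n => nr (e n x) ^+ 2) (nr x ^+ 2) _ _ (d ^+ 2).
  - by move=> n m nm; rewrite -subr_ge0 -pyth// sqr_ge0.
  - by move=> n; rewrite ler_sqr ?nnegrE ?nr_ge0 ?proj_nr.
  - by rewrite exprn_gt0.
  exists n => m nm; rewrite -ltr_sqr ?nnegrE ?nr_ge0 ?(ltW d0)// pyth//.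
  exact: nP.
have eP n x : e n (P x) = e n x.
  have h := tends_op (proj_bounded (pe n)) (PP x).
  apply: tends_uniq (tends_shift n h) _ => d d0; exists 0%N => m _ /=.
  have /(congr1 (@^~ x))/= -> := ie' n (n + m)%N (leq_addr _ _).
  by rewrite subrr nr0.
have lP : linear P.
  move=> a x y; apply: tends_uniq (PP _) _.
  have := tends_linear a (PP x) (PP y); congr tends.
  by apply/funext => n; rewrite (proj_lin (pe n)).
exists P; split=> //; last by move=> n; apply/funext => x /=; rewrite eP.
split.
- apply/bounded_opP; split=> //; exists 1 => // x; rewrite mul1r.
  by apply: tends_nr_le (PP x) _ => n; exact: proj_nr.
- move=> x y; apply/subr0_eq/(@nr_eps _ _ _ (nr y + nr x)) => d d0.
  have [n nP] := PP x _ d0; have [n' n'P] := PP y _ d0.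
  pose m := maxn n n'; have hx := nP m (leq_maxl _ _); have hy := n'P m (leq_maxr _ _).
  have -> : dot (P x) y - dot x (P y) = dot (P x - e m x) y - dot x (P y - e m y).
    by rewrite dotBl dotBr (proj_adj (pe m)) opprB subrKA.
  rewrite (le_trans (nrD _ _))// nrN mulrDl lerD// (le_trans (cauchy_schwarz _ _))//.
    by rewrite mulrC ler_wpM2l ?nr_ge0// ltW.
  by rewrite ler_wpM2l ?nr_ge0// ltW.
apply/funext => x /=; apply: tends_uniq (PP _) _.
by have := PP x; congr tends; apply/funext => n; rewrite eP.
Qed.

End Projections.

Section Diffuse.
Variables (R : realType) (K : hilbertType R) (M : set (K -> K)).
Variable (tau : (K -> K) -> R[i]).
Hypotheses (vnM : von_neumann M) (trM : faithful_normal_trace M tau).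
Variable E : L2 M tau.
Variable N : set (K -> K).
Hypotheses (vnN : von_neumann N) (sNM : N `<=` M) (dN : diffuse N).
Implicit Types (e f g P : K -> K).

Definition proj_in P := N P /\ projection P.
(** The trace of a projection as an element of [R]; see [massE]. *)
Definition mass P : R := nr (L2_vec E P) ^+ 2.

Lemma mass_ge0 P : 0 <= mass P. Proof. by rewrite exprn_ge0 ?nr_ge0. Qed.

Lemma massE P : proj_in P -> (mass P)%:C = tau P.
Proof.
move=> [NP [bP aP PP]]; rewrite /mass (L2_vec_norm _ _ aP); last exact: sNM.
by rewrite PP.
Qed.

Lemma mass_gt0 P : proj_in P -> P <> 0 -> 0 < mass P.
Proof.
move=> [NP pP] P0; rewrite lt_neqAle mass_ge0 andbT eq_sym; apply/eqP => /eqP.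
rewrite sqrf_eq0 => /eqP/nr_eq0 v0; apply: P0.
exact: (L2_vec_inj vnM trM (sNM NP) v0).
Qed.

Lemma tau_add S T : M S -> M T -> tau (S + T) = tau S + tau T.
Proof.
move=> MS MT; have -> : S + T = (1 : R[i]) *: S + T by rewrite scale1r.
by rewrite (tr_linear trM)// mul1r.
Qed.

Lemma proj_in_add e f : proj_in e -> proj_in f -> e \o f = 0 -> proj_in (e + f).
Proof. by move=> [Ne pe] [Nf pf] ef; split; [exact: vn_D|exact: proj_add]. Qed.

Lemma proj_in_sub e f : proj_in e -> proj_in f -> e \o f = f -> proj_in (e - f).
Proof. by move=> [Ne pe] [Nf pf] ef; split; [exact: vn_B|exact: proj_sub]. Qed.

Lemma proj_in_id : proj_in id.
Proof. by split; [exact: vn_id|exact: proj_id]. Qed.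

Lemma proj_in0 : proj_in 0.
Proof.
split; last exact: proj0.
by have := vn_B vnN (vn_id vnN) (vn_id vnN); rewrite subrr.
Qed.

Lemma mass_add e f : proj_in e -> proj_in f -> e \o f = 0 ->
  mass (e + f) = mass e + mass f.
Proof.
move=> pe pf ef; apply: complexI; rewrite rmorphD/= !massE//; last exact: proj_in_add.
by rewrite tau_add//; apply: sNM; [case: pe|case: pf].
Qed.

Lemma mass_id : mass id = 1.
Proof. by apply: complexI; rewrite (massE proj_in_id) (tr_one trM). Qed.

Lemma mass0 : mass 0 = 0.
Proof.
apply: complexI; rewrite (massE proj_in0); apply: (addrI (tau 0)).
by rewrite -(tau_add (sNM proj_in0.1) (sNM proj_in0.1)) !addr0.
Qed.

Lemma subrK_fun e f : e - f + f = e.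
Proof. exact: subrK. Qed.

Lemma sub_orth e f : projection e -> projection f -> e \o f = f -> (e - f) \o f = 0.
Proof.
move=> pe pf ef; apply/funext => x; rewrite /= !fctE proj_idem//.
by have /(congr1 (@^~ x))/= -> := ef; rewrite subrr.
Qed.

Lemma mass_sub e f : proj_in e -> proj_in f -> e \o f = f ->
  mass (e - f) = mass e - mass f.
Proof.
move=> pe pf ef; apply/eqP; rewrite eq_sym subr_eq; apply/eqP.
have h := sub_orth pe.2 pf.2 ef.
by rewrite -(mass_add (proj_in_sub pe pf ef) pf h) subrK_fun.
Qed.

(** No projection of [N] is minimal, so a nonzero [g] splits into two nonzero projections of [N],
    one of which has at most half the mass. Iterating stays below [r]. *)
Lemma small_projection r (eps : R) : proj_in r -> r <> 0 -> 0 < eps ->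
  exists g, [/\ proj_in g, g <> 0, r \o g = g & mass g <= eps].
Proof.
move=> pr r0 eps0.
have half k : exists g, [/\ proj_in g, g <> 0, r \o g = g & mass g * 2 ^+ k <= mass r].
  elim: k => [|k [g [pg g0 rg gk]]].
    exists r; split=> //; first by case: pr => _ [].
    by rewrite expr0 mulr1.
  have [Q [pQ Q0 Qg gQ]] : exists Q, [/\ proj_in Q, Q <> 0, Q <> g & g \o Q = Q].
    apply: contrapT => noQ; apply: dN; exists g; case: (pg) => Ng pjg.
    split=> // Q NQ pjQ Qg; apply: contrapT => /not_orP[Q0 Qg'].
    by apply: noQ; exists Q; split=> //; exact: proj_le.
  have rQ : r \o Q = Q by rewrite -gQ compA rg.
  have pgQ := proj_in_sub pg pQ gQ; have mgQ := mass_sub pg pQ gQ.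
  have [Qh|Qh] := leP (mass Q * 2) (mass g).
    exists Q; split=> //; rewrite exprS mulrA (le_trans _ gk)//.
    by rewrite ler_wpM2r// exprn_ge0.
  exists (g - Q); split=> //.
  - by move/subr0_eq => /esym.
  - apply/funext => x; rewrite /= !fctE (linear_mapB _ _ (proj_lin pr.2)).
    have /(congr1 (@^~ x))/= -> := rg; have /(congr1 (@^~ x))/= -> := rQ.
    by [].
  rewrite exprS mulrA (le_trans _ gk)// ler_wpM2r ?exprn_ge0// mgQ.
  lra.
have [k kP] : exists k, mass r <= eps * 2 ^+ k.
  have [k kP] := @invS_lt R (eps / (mass r + 1)) (divr_gt0 eps0 (ltr_wpDl (mass_ge0 r) ltr01)).
  exists k; have := kP k (leqnn _).
  rewrite ltr_pdivlMr ?ltr_wpDl ?mass_ge0// mulrC ltr_pdivrMr// => h.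
  have : eps * k.+1%:R <= eps * 2 ^+ k.
    by rewrite ler_wpM2l ?(ltW eps0)// -natrX ler_nat ltn_expl.
  lra.
have [g [pg g0 rg gk]] := half k; exists g; split=> //.
have : mass g * 2 ^+ k <= eps * 2 ^+ k by lra.
by rewrite ler_pM2r// exprn_gt0.
Qed.

(* Greedily adding an almost largest admissible projection exhausts the identity
   up to a remainder, which is itself small by normality of the trace. *)
Lemma diffuse_induction (Q : (K -> K) -> Prop) (eps : R) : 0 < eps -> Q 0 ->
  (forall e f, proj_in e -> proj_in f -> e \o f = 0 -> mass f <= eps -> Q e -> Q (e + f)) ->
  Q id.
Proof.
move=> eps0 Q0 QD.
pose cand e f := [/\ proj_in f, e \o f = 0 & mass f <= eps].
(* The supremum of the admissible masses need not be attained, but unless it is 0 some mass exceeds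
   half of it: hence the factor 2. *)
have /choice[s sP] : forall e, exists f, proj_in e -> cand e f /\
    forall g, cand e g -> mass g <= 2 * mass f.
  move=> e; have [pe|npe] := pselect (proj_in e); last by exists 0.
  pose S := mass @` [set f | cand e f].
  have c0 : cand e 0.
    split; [exact: proj_in0| |by rewrite mass0 ltW].
    by apply/funext => x /=; rewrite (linear_map0 (proj_lin pe.2)).
  have hS : has_sup S.
    by split; [exists (mass 0), 0|exists eps => _ [f [_ _ ?] <-]].
  have ubS g : cand e g -> mass g <= sup S.
    by move=> cg; apply: sup_ubound; [exact: hS.2|exists g].
  have [s0|s0] := leP (sup S) 0.
    by exists 0 => _; split=> // g /ubS; rewrite mass0 mulr0 => /le_trans; apply.
  have [_ [f cf <-] fP] := sup_adherent (divr_gt0 s0 (ltr0Sn R 1)) hS.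
  by exists f => _; split=> // g /ubS; lra.
pose u := fix u n := if n is n'.+1 then u n' + s (u n') else 0.
have up n : proj_in (u n).
  elim: n => [|n IH /=]; first exact: proj_in0.
  by have [[ps us _] _] := sP _ IH; exact: proj_in_add.
have pu n := (up n).2.
have Qu n : Q (u n).
  elim: n => [//|n IH /=].
  by have [[ps us ms] _] := sP _ (up n); exact: QD.
have ui n m : (n <= m)%N -> u m \o u n = u n.
  move=> /subnK <-; elim: (m - n)%N => [|k IH]; first by case: (up n) => _ [].
  have [[ps us ms] _] := sP _ (up (k + n)%N).
  have su := orth_sym (proj_adj (up (k + n)%N).2) (proj_adj ps.2) (proj_lin (up (k + n)%N).2) us.
  apply/funext => x; rewrite addSn /= !fctE.
  have /(congr1 (@^~ x))/= h := IH; rewrite h -[in X in _ + X]h.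
  by have /(congr1 (@^~ (u n x)))/= -> := su; rewrite addr0.
have msum n : mass (u n) = \sum_(k < n) mass (s (u k)).
  elim: n => [|n IH]; first by rewrite big_ord0 mass0.
  have [[ps us ms] _] := sP _ (up n).
  by rewrite big_ord_recr -IH /= mass_add.
have mle n : mass (u n) <= 1.
  have := mass_sub proj_in_id (up n) erefl; rewrite mass_id.
  by have := mass_ge0 (id - u n); lra.
have [P [pP uP tP]] := proj_sup (fun n => (up n).2) ui.
have NP : N P.
  rewrite (vn_bicommutant vnN); split; first exact: proj_bounded.
  move=> S [bS cS]; apply/funext => x /=; apply: tends_uniq (tP _) _.
  have := tends_op bS (tP x); congr tends; apply/funext => n /=.
  by have /(congr1 (@^~ x))/= -> := cS _ (up n).1.
(* Otherwise a nonzero [g] of mass at most [eps] lies below [id - P] and is admissible at every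
   stage. Each step then adds at least half the mass of [g], which exceeds the total mass 1 after
   finitely many steps. *)
have P1 : P = id.
  apply: contrapT => P1.
  have pr : proj_in (id - P) by apply: proj_in_sub; [exact: proj_in_id|split|].
  have r0 : id - P <> 0 by move=> /subr0_eq /esym.
  have [g [pg g0 rg gm]] := small_projection pr r0 eps0.
  have cg n : cand (u n) g.
    split=> //; apply/funext => x /=; have /(congr1 (@^~ x))/= <- := rg.
    rewrite /= !fctE (linear_mapB _ _ (proj_lin (up n).2)).
    by have /(congr1 (@^~ (g x)))/= -> := uP n; rewrite subrr.
  have g1 := mass_gt0 pg g0.
  have [n nP] := @invS_lt R (mass g / 2) (divr_gt0 g1 (ltr0Sn R 1)).
  have : n.+1%:R * (mass g / 2) <= 1.
    apply: le_trans (mle n.+1); rewrite msum -[n.+1 in X in X%:R * _]card_ord mulr_natl -sumr_const.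
    apply: ler_sum => k _; have [_ /(_ g (cg _))] := sP _ (up k); lra.
  have := nP n (leqnn _); rewrite -[n.+1%:R^-1]mul1r ltr_pdivrMr// mulrC; lra.
(* If not, tau(u n) <= 1 - eps for all n; since [u n] increases to the identity, normality gives
   tau(id) <= 1 - eps. *)
have [n nP] : exists n, mass (id - u n) <= eps.
  apply: contrapT => /forallNP no.
  have small n : mass (u n) <= 1 - eps.
    have := mass_sub proj_in_id (up n) erefl; rewrite mass_id.
    by have /negP := no n; rewrite -ltNge; lra.
  have inc : increasing_to M (range u) id.
    split.
    - by move=> _ [n _ <-]; split; [exact: (sNM (up n).1)|exact: (proj_adj (up n).2)].
    - by exists (u 0%N), 0%N.
    - move=> _ _ [n _ <-] [m _ <-]; exists (u (maxn n m)).
      have le k l : (k <= l)%N -> op_le (u k) (u l).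
        move=> kl x; rewrite (proj_dot _ (pu k)) (proj_dot _ (pu l)) lecR.
        rewrite ler_sqr ?nnegrE ?nr_ge0//.
        suff -> : u k x = u k (u l x) by exact: proj_nr.
        apply: dot_inj => y; rewrite !(proj_adj (pu k)) (proj_adj (pu l)).
        by have /(congr1 (@^~ y))/= -> := ui _ _ kl.
      by split; [exists (maxn n m)|exact/le/leq_maxl|exact/le/leq_maxr].
    - split; first by split; [exact: vn_id|].
      move=> _ [n _ <-] x; rewrite (proj_dot _ (pu n)) dotx lecR.
      by rewrite ler_sqr ?nnegrE ?nr_ge0//; exact: proj_nr.
    move=> T [MT aT] uT x.
    have h n := uT _ (imageT u n) x.
    have := h 0%N; rewrite dot0l => T0.
    have TE : dot (T x) x = (complex.Re (dot (T x) x))%:C by rewrite RRe_real// ger0_real.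
    (* Square roots are taken so that the claim bounds the norm of a limit: [u n x] tends to [x],
       and each of its norms is at most the root of <T x, x>. *)
    rewrite TE dotx lecR -(@sqr_sqrtr _ (complex.Re (dot (T x) x))); last first.
      by rewrite -ler0c -TE.
    rewrite ler_sqr ?nnegrE ?nr_ge0 ?sqrtr_ge0//.
    have := tP x; rewrite P1 => /tends_nr_le; apply => n.
    have := h n; rewrite (proj_dot _ (pu n)) TE lecR => hn.
    by rewrite -[leLHS]ger0_norm ?nr_ge0// -sqrtr_sqr ler_wsqrtr.
  suff : tau id <= (1 - eps)%:C by rewrite -(massE proj_in_id) mass_id lecR; lra.
  by apply: (tr_normal trM inc) => _ [n _ <-]; rewrite -(massE (up n)) lecR.
have -> : (id : K -> K) = u n + (id - u n) by rewrite addrC subrK_fun.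
apply: QD => //.
- by apply: proj_in_sub; [exact: proj_in_id|exact: up|].
apply/funext => x; rewrite /= !fctE (linear_mapB _ _ (proj_lin (up n).2)).
by rewrite proj_idem ?subrr//; case: (up n).
Qed.

End Diffuse.

Lemma closed_subspace_all (R : realType) (H : hilbertType R) (I : Type) (W : I -> set H) :
  (forall i, closed_subspace (W i)) -> closed_subspace [set x | forall i, W i x].
Proof.
move=> cW; split=> [|i|a x y Wx Wy i].
- apply/closed_nrP => x xP i; have [/closed_nrP + _ _] := cW i; apply=> e e0.
  by have [y Wy xy] := xP e e0; exists y.
- by have [] := cW i.
by have [_ _] := cW i; apply.
Qed.

Lemma closed_subspace_preimage (R : realType) (H : hilbertType R) (T : H -> H) (W : set H) :
  bounded_op T -> closed_subspace W -> closed_subspace (T @^-1` W).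
Proof.
move=> bT [/closed_nrP cW W0 WL]; have lT := bounded_op_lin bT.
have [C C0 bC] := bounded_op_bound bT.
split=> [||a x y Wx Wy].
- apply/closed_nrP => x xP; apply: cW => e e0.
  have [|y Wy xy] := xP (e / (C + 1)); first by rewrite divr_gt0// ltr_wpDl.
  exists (T y) => //; rewrite -(linear_mapB _ _ lT) (le_lt_trans (bC _))//.
  move: xy; rewrite ltr_pdivlMr ?ltr_wpDl// => xy.
  by have := nr_ge0 (x - y); lra.
- by rewrite /preimage/= (linear_map0 lT).
by rewrite /preimage/= lT; exact: WL.
Qed.

(** * Right multiplications and the commutant of N *)

Section Cyclic.
Variables (R : realType) (E1 E2 : hilbertType R) (xi1 : E1) (xi2 : E2).
Hypotheses (xi1_unit : dot xi1 xi1 = 1) (xi2_unit : dot xi2 xi2 = 1).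

Definition cyclic_for (E : hilbertType R) (xi : E) (X : set (E -> E)) :=
  X `<=` @bounded_op R E /\
  forall x (e : R), 0 < e -> exists2 T, X T & nr (x - T xi) < e.

Lemma fp_cyclic_step (F : free_product xi1 xi2) (W : set F) X :
  cyclic_for xi1 X -> closed_subspace W ->
  (forall T x, X T -> W x -> W (fp_rep1 F T x)) ->
  forall w, reduced_off_left xi1 xi2 w -> W (fp_word F w) ->
  forall h, W (fp_V1 F h w).
Proof.
move=> [bX dX] [/closed_nrP cW W0 WL] WX w ow Ww h; apply: cW => e e0.
have w0 := nr_ge0 (fp_word F w).
have [|T XT hT] := dX h (e / (nr (fp_word F w) + 1)); first by rewrite divr_gt0// ltr_wpDl.
exists (fp_V1 F (T xi1) w).
  by rewrite -fp_rep1_V ?V1_xi//; [exact: WX|exact: bX].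
have -> : fp_V1 F h w - fp_V1 F (T xi1) w = fp_V1 F (h - T xi1) w.
  have := V1_linear xi1_unit F (-1) (T xi1) h ow.
  by rewrite !scaleN1r [- T xi1 + h]addrC => ->; rewrite addrC.
rewrite nr_V1//; move: hT; rewrite ltr_pdivlMr ?ltr_wpDl// => hT.
by have := nr_ge0 (h - T xi1); lra.
Qed.

End Cyclic.

(** Words grow from the left: [T] maps xi (x) w, which is the word [w], to T xi (x) w, and the
    vectors T xi are dense. The sets [X1] and [X2] are left open so that both left and right
    multiplications can be inserted. *)
Lemma fp_cyclic (R : realType) (E1 E2 : hilbertType R) (xi1 : E1) (xi2 : E2)
    (F : free_product xi1 xi2) (W : set F) X1 X2 :
  dot xi1 xi1 = 1 -> dot xi2 xi2 = 1 ->
  cyclic_for xi1 X1 -> cyclic_for xi2 X2 -> closed_subspace W ->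
  W (fp_word F [::]) ->
  (forall T x, X1 T -> W x -> W (fp_rep1 F T x)) ->
  (forall T x, X2 T -> W x -> W (fp_rep2 F T x)) -> W = setT.
Proof.
move=> u1 u2 c1 c2 cW W0 W1 W2; apply: (fp_word_total cW) => w.
elim: w => [//|[h|h] w IH].
  rewrite reduced_inl => /andP[/eqP h0 ow]; rewrite -V1_centred//.
  apply: (fp_cyclic_step u1 c1) => //.
  exact/IH/(off1_red ow).
rewrite reduced_inr => /andP[/eqP h0 ow]; rewrite -V2_centred// V2_swap.
apply: (@fp_cyclic_step _ _ _ _ _ u2 (free_product_swap F) W X2) => //.
  exact: off2_swap.
by rewrite /= map_swapK; apply: IH; case/andP: ow.
Qed.

Section FreeProduct.
Variables (R : realType) (K1 K2 : hilbertType R)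
  (M1 : set (K1 -> K1)) (tau1 : (K1 -> K1) -> R[i])
  (M2 : set (K2 -> K2)) (tau2 : (K2 -> K2) -> R[i])
  (vnM1 : von_neumann M1) (tr1 : faithful_normal_trace M1 tau1)
  (vnM2 : von_neumann M2) (tr2 : faithful_normal_trace M2 tau2)
  (E1 : L2 M1 tau1) (E2 : L2 M2 tau2) (F : L2_free_product E1 E2).
Local Notation v1 := (L2_vec E1).
Local Notation v2 := (L2_vec E2).
Local Notation xi1 := (v1 id).
Local Notation xi2 := (v2 id).
Local Notation word := (fp_word F).
Local Notation V1 := (fp_V1 F).
Local Notation Om := (word [::]).
Local Notation off1 := (reduced_off_left xi1 xi2).

Let xi1_unit : dot xi1 xi1 = 1 := L2_xi_norm vnM1 tr1 E1.
Let xi2_unit : dot xi2 xi2 = 1 := L2_xi_norm vnM2 tr2 E2.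

Variable Sg : F -> F.
Hypothesis flipS : is_flip Sg.

Definition right_emb1 (a : K1 -> K1) : F -> F := rho1 Sg (right_mul E1 a).
Definition right_emb2 (a : K2 -> K2) : F -> F := rho2 Sg (right_mul E2 a).

Let bL1 S : M1 S -> bounded_op (L2_mul E1 S). Proof. exact: L2_mul_bound. Qed.
Let bL2 S : M2 S -> bounded_op (L2_mul E2 S). Proof. exact: L2_mul_bound. Qed.
Let bR1 a : M1 a -> bounded_op (right_mul E1 a).
Proof. exact: (right_mul_bounded vnM1 tr1). Qed.
Let bR2 a : M2 a -> bounded_op (right_mul E2 a).
Proof. exact: (right_mul_bounded vnM2 tr2). Qed.

Lemma emb1_bounded S : M1 S -> bounded_op (emb1 F S).
Proof. by move=> /bL1; exact: fp_rep1_bounded. Qed.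
Lemma emb2_bounded S : M2 S -> bounded_op (emb2 F S).
Proof. by move=> /bL2; exact: fp_rep2_bounded. Qed.
Lemma right_emb1_bounded a : M1 a -> bounded_op (right_emb1 a).
Proof. by move=> /bR1; exact: rho1_bounded. Qed.
Lemma right_emb2_bounded a : M2 a -> bounded_op (right_emb2 a).
Proof. by move=> /bR2; exact: rho2_bounded. Qed.

Lemma emb1_adjoint S S' : M1 S -> M1 S' -> adjoint S S' -> adjoint (emb1 F S) (emb1 F S').
Proof.
move=> MS MS' SS; apply: (rep1_adjoint xi1_unit); [exact: bL1|exact: bL1|].
exact: L2_mul_adjoint.
Qed.

Lemma right_emb1_adjoint a a' : M1 a -> M1 a' -> adjoint a a' ->
  adjoint (right_emb1 a) (right_emb1 a').
Proof.
move=> Ma Ma' aa; apply: (rho1_adjoint xi1_unit flipS); [exact: bR1|exact: bR1|].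
exact: (right_mul_adjoint vnM1 tr1).
Qed.

Lemma right_emb2_adjoint a a' : M2 a -> M2 a' -> adjoint a a' ->
  adjoint (right_emb2 a) (right_emb2 a').
Proof.
move=> Ma Ma' aa.
apply: (@rho1_adjoint _ _ _ _ _ xi2_unit (free_product_swap F) _ (flip_swap flipS));
  [exact: bR2|exact: bR2|].
exact: (right_mul_adjoint vnM2 tr2).
Qed.

Lemma emb1_linear a S T : M1 S -> M1 T ->
  emb1 F (a *: S + T) = a *: emb1 F S + emb1 F T.
Proof.
move=> MS MT; rewrite /emb1 (L2_mul_linear vnM1)// (rep1_linear xi1_unit)//; exact: bL1.
Qed.

Lemma emb1_comp S T : M1 S -> M1 T -> emb1 F (S \o T) = emb1 F S \o emb1 F T.
Proof.
move=> MS MT; rewrite /emb1 (L2_mul_comp vnM1)// (rep1_comp xi1_unit)//; exact: bL1.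
Qed.

Lemma emb1_id : emb1 F id = id.
Proof. by rewrite /emb1 (L2_mul_id vnM1) (rep1_id xi1_unit). Qed.

Lemma emb1_0 : emb1 F 0 = 0.
Proof.
have M0 : M1 0 by have := vn_B vnM1 (vn_id vnM1) (vn_id vnM1); rewrite subrr.
by have := emb1_linear (-1) M0 M0; rewrite scaler0 addr0 scaleN1r addNr.
Qed.

Lemma emb1_D S T : M1 S -> M1 T -> emb1 F (S + T) = emb1 F S + emb1 F T.
Proof.
move=> MS MT; have -> : S + T = (1 : R[i]) *: S + T by rewrite scale1r.
by rewrite emb1_linear// scale1r.
Qed.

Lemma emb1_right_emb1 S a : M1 S -> M1 a -> emb1 F S \o right_emb1 a = right_emb1 a \o emb1 F S.
Proof.
move=> MS Ma; apply: (rep1_rho1 xi1_unit flipS); [exact: bL1|exact: bR1|].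
exact: (right_mul_mulC vnM1 tr1).
Qed.

Lemma emb1_right_emb2 S a : M1 S -> M2 a -> emb1 F S \o right_emb2 a = right_emb2 a \o emb1 F S.
Proof. by move=> MS Ma; apply: (rep1_rho2 xi1_unit xi2_unit flipS); [exact: bL1|exact: bR2]. Qed.

Lemma emb2_right_emb1 S a : M2 S -> M1 a -> emb2 F S \o right_emb1 a = right_emb1 a \o emb2 F S.
Proof. by move=> MS Ma; apply: (rep2_rho1 xi1_unit xi2_unit flipS); [exact: bL2|exact: bR1]. Qed.

Lemma emb2_right_emb2 S a : M2 S -> M2 a -> emb2 F S \o right_emb2 a = right_emb2 a \o emb2 F S.
Proof.
move=> MS Ma.
apply: (@rep1_rho1 _ _ _ _ _ xi2_unit (free_product_swap F) _ (flip_swap flipS));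
  [exact: bL2|exact: bR2|].
exact: (right_mul_mulC vnM2 tr2).
Qed.

Lemma emb_cyclic (W : set F) : closed_subspace W -> W Om ->
  (forall S x, M1 S -> W x -> W (emb1 F S x)) ->
  (forall S x, M2 S -> W x -> W (emb2 F S x)) -> W = setT.
Proof.
move=> cW W0 W1 W2.
apply: (@fp_cyclic _ _ _ _ _ F W (L2_mul E1 @` M1) (L2_mul E2 @` M2)) => //.
- split=> [_ [S MS <-]|x e e0]; first exact: bL1.
  have [S MS xS] := L2_dense x e0; exists (L2_mul E1 S); first by exists S.
  by rewrite L2_mul_xi.
- split=> [_ [S MS <-]|x e e0]; first exact: bL2.
  have [S MS xS] := L2_dense x e0; exists (L2_mul E2 S); first by exists S.
  by rewrite L2_mul_xi.
- by move=> _ x [S MS <-]; exact: W1.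
- by move=> _ x [S MS <-]; exact: W2.
Qed.

Lemma right_emb_cyclic (W : set F) : closed_subspace W -> W Om ->
  (forall a x, M1 a -> W x -> W (right_emb1 a x)) ->
  (forall a x, M2 a -> W x -> W (right_emb2 a x)) -> W = setT.
Proof.
move=> cW W0 W1 W2.
have SgK := flipK flipS.
(* Conjugated by the flip, [right_emb1 a] becomes the left action of the operator [right_mul E1 a],
   so [fp_cyclic] applies with right multiplications as the operators on the two factors. *)
suff WS : Sg @^-1` W = setT.
  apply/seteqP; split=> // x _; rewrite -(SgK x).
  by have : (Sg @^-1` W) (Sg x) by rewrite WS.
apply: (@fp_cyclic _ _ _ _ _ F _ (right_mul E1 @` M1) (right_mul E2 @` M2)) => //.
- split=> [_ [S MS <-]|x e e0]; first exact: bR1.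
  have [S MS xS] := L2_dense x e0; exists (right_mul E1 S); first by exists S.
  by rewrite (right_mul_xi vnM1 tr1).
- split=> [_ [S MS <-]|x e e0]; first exact: bR2.
  have [S MS xS] := L2_dense x e0; exists (right_mul E2 S); first by exists S.
  by rewrite (right_mul_xi vnM2 tr2).
- exact: closed_subspace_preimage (flip_bounded flipS) cW.
- by rewrite /preimage/= (flip_word flipS).
- move=> _ x [a Ma <-] /(W1 a _ Ma); rewrite /right_emb1 /rho1 /= SgK.
  by [].
- move=> _ x [a Ma <-] /(W2 a _ Ma); rewrite /right_emb2 /rho2 /= SgK.
  by [].
Qed.

Variable N : set (K1 -> K1).
Hypotheses (vnN : von_neumann N) (sNM : N `<=` M1) (dN : diffuse N).

Section Commuting.
Variable p : F.
Hypothesis pP : forall e, proj_in N e -> emb1 F e p = right_emb1 e p.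

(* [p] satisfies e p = e p e, so <e p, y> <= |e p| |e y e| <= |e p| B tau(e). *)
Lemma commuting_orth a b c : M1 a -> M1 b -> c != [::] -> off1 c -> off1 (rev c) ->
  dot p (V11 F (v1 a) c (v1 b)) = 0.
Proof.
move=> Ma Mb c0 oc oc'; set y := V11 _ _ _ _.
have [Ca Ca0 bCa] := bounded_op_bound (bR1 Ma).
have [Cb Cb0 bCb] := bounded_op_bound (bL1 Mb).
pose B := Ca * Cb * nr (word c).
have B0 : 0 <= B by rewrite !mulr_ge0 ?nr_ge0.
pose q e := emb1 F e p.
have qy e : proj_in N e -> nr (dot (q e) y) <= nr (q e) * (B * mass E1 e).
  move=> [Ne pe]; have Me := sNM Ne; have [_ ae ee] := pe.
  have qq : emb1 F e (emb1 F e p) = emb1 F e p.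
    by have := emb1_comp Me Me; rewrite ee => /(congr1 (@^~ p)) /esym.
  have qE : q e = right_emb1 e (emb1 F e (q e)).
    rewrite /q qq -[LHS]qq {1}pP//.
    by have /(congr1 (@^~ p)) := emb1_right_emb1 Me Me.
  rewrite {1}qE (right_emb1_adjoint Me Me ae) (emb1_adjoint Me Me ae).
  rewrite (le_trans (cauchy_schwarz _ _))// ler_wpM2l ?nr_ge0//.
  rewrite /y /right_emb1 (rho1_V11 xi1_unit flipS)//; last exact: bR1.
  rewrite /emb1 (rep1_V11 xi1_unit)//; last exact: bL1.
  rewrite (nr_V11 xi1_unit)// right_mul_vec// L2_mul_vec//.
  (* The vector of e a is [v1 e] multiplied on the right by [a], that of b e is [v1 e] multiplied on
     the left by [b]; both norms are bounded by a constant times tau(e)^(1/2). *)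
  rewrite -(right_mul_vec vnM1 tr1)// -[v1 (b \o e)](L2_mul_vec E1 Me Mb).
  rewrite /mass /B expr2.
  have h1 := bCa (v1 e); have h2 := bCb (v1 e).
  have -> : Ca * Cb * nr (word c) * (nr (v1 e) * nr (v1 e)) =
     (Ca * nr (v1 e)) * (Cb * nr (v1 e)) * nr (word c) by ring.
  by rewrite ler_wpM2r ?nr_ge0// ler_pM ?nr_ge0.
have q1 : q id = p by rewrite /q emb1_id.
(* Cauchy-Schwarz over a partition becomes a bound that is additive over orthogonal projections, as
   an induction needs: |q e|^2 and [mass] both add up. The weight [t] comes from AM-GM, and masses
   at most [t ^+ 2] turn B^2 mass^2 / t into at most t B^2 mass. *)
suff key (t : R) : 0 < t -> 2 * nr (dot p y) <= t * (nr p ^+ 2 + B ^+ 2).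
  apply: (@nr_eps _ _ _ ((nr p ^+ 2 + B ^+ 2) / 2)) => t /key.
  lra.
move=> t0.
have := @diffuse_induction _ _ _ _ vnM1 tr1 E1 _ vnN sNM dN
  (fun e => 2 * nr (dot (q e) y) <= t * nr (q e) ^+ 2 + t * B ^+ 2 * mass E1 e) (t ^+ 2).
rewrite q1 (mass_id tr1 E1 vnN sNM) mulr1 mulrDr; apply.
- by rewrite exprn_gt0.
- have -> : q 0 = 0 by rewrite /q emb1_0.
  rewrite dot0l !nr0 mulr0 expr0n/= mulr0 add0r.
  exact: mulr_ge0 (mulr_ge0 (ltW t0) (sqr_ge0 _)) (mass_ge0 _ _).
move=> e f pe pf ef mf Qe.
have Me := sNM pe.1; have Mf := sNM pf.1.
have qef : q (e + f) = q e + q f by rewrite /q emb1_D.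
have orth : dot (q e) (q f) = 0.
  rewrite (emb1_adjoint Me Me (proj_adj pe.2)).
  have := emb1_comp Me Mf; rewrite ef emb1_0 => /(congr1 (@^~ p)) /= <-.
  by rewrite dot0r.
have Qf : 2 * nr (dot (q f) y) <= t * nr (q f) ^+ 2 + t * B ^+ 2 * mass E1 f.
  have h := qy _ pf; have m0 := mass_ge0 E1 f.
  (* AM-GM for [t^(1/2) nr (q f)] and [t^(-1/2) B (mass f)] *)
  have amgm : 2 * (nr (q f) * (B * mass E1 f)) <=
      t * nr (q f) ^+ 2 + B ^+ 2 * mass E1 f ^+ 2 / t.
    rewrite -subr_ge0.
    have -> : t * nr (q f) ^+ 2 + B ^+ 2 * mass E1 f ^+ 2 / t -
        2 * (nr (q f) * (B * mass E1 f)) = (t * nr (q f) - B * mass E1 f) ^+ 2 / t.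
      by field; rewrite gt_eqF.
    by rewrite divr_ge0 ?sqr_ge0// ltW.
  have : B ^+ 2 * mass E1 f ^+ 2 / t <= t * B ^+ 2 * mass E1 f.
    rewrite ler_pdivrMr//.
    have -> : t * B ^+ 2 * mass E1 f * t = B ^+ 2 * (mass E1 f * t ^+ 2) by ring.
    by rewrite ler_wpM2l ?sqr_ge0// expr2 ler_wpM2l.
  lra.
rewrite qef (mass_add tr1 E1 vnN sNM)// nrD_sqr orth dotDl/=.
have := nrD (dot (q e) y) (dot (q f) y).
lra.
Qed.

(** The estimate above uses that multiplication by [a] and by [b] is bounded; general legs follow by
    density, one leg at a time. *)
Lemma commuting_orth_V11 h c g : c != [::] -> off1 c -> off1 (rev c) ->
  dot p (V11 F h c g) = 0.
Proof.
move=> c0 oc oc'.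
have dD (x : E1) (e : R) : 0 < e -> exists2 y, (v1 @` M1) y & nr (x - y) < e.
  by move=> e0; have [S MS xS] := L2_dense x e0; exists (v1 S) => //; exists S.
have sub x y z z' : V11 F (x - y) c z = V11 F x c z - V11 F y c z /\
    V11 F z' c (x - y) = V11 F z' c x - V11 F z' c y.
  have h1 := V11_linear_left xi1_unit F (-1) y x z c0 oc oc'.
  have h2 := V11_linear_right xi1_unit flipS (-1) z' y x c0 oc oc'.
  by rewrite !scaleN1r ![- y + x]addrC ![- V11 _ _ _ _ + _]addrC in h1 h2.
have bd x z : nr (dot (V11 F x c z) p) <= nr x * nr z * nr (word c) * nr p.
  by rewrite (le_trans (cauchy_schwarz _ _))// (nr_V11 xi1_unit).
rewrite dotC; apply: (can_inj (@conjCK _)); rewrite conjCK rmorph0; move: g.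
apply: (@linear_eq_dense _ _ _ (fun g => dot (V11 F h c g) p) _ (v1 @` M1)
  _ (_ : forall g, _ <= nr h * nr (word c) * nr p * nr g)) => //.
- by move=> x y; rewrite (sub x y x h).2 dotBl.
- by move=> g; rewrite (le_trans (bd _ _))// le_eqVlt; apply/orP; left; apply/eqP; ring.
move=> _ [b Mb <-]; move: h.
apply: (@linear_eq_dense _ _ _ (fun h => dot (V11 F h c (v1 b)) p) _ (v1 @` M1)
  _ (_ : forall h, _ <= nr (v1 b) * nr (word c) * nr p * nr h)) => //.
- by move=> x y; rewrite (sub x y (v1 b) x).1 dotBl.
- by move=> h; rewrite (le_trans (bd _ _))// le_eqVlt; apply/orP; left; apply/eqP; ring.
by move=> _ [a Ma <-]; rewrite dotC commuting_orth// rmorph0.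
Qed.

(** The vectors [V1 x [::]] form L^2(M1), and all other words are of the form [V11], to which [p] is
    orthogonal. Riesz supplies the L^2(M1) component of [p], and it is all of [p]. *)
Lemma commuting_vec : exists x, p = V1 x [::].
Proof.
have on : off1 [::] by [].
have [||g gP] := @riesz _ _ (fun h => dot (V1 h [::]) p) (nr Om * nr p).
- by move=> a x y; rewrite (V1_linear xi1_unit)// dotDl dotZl.
- move=> h; rewrite (le_trans (cauchy_schwarz _ _))// (nr_V1 xi1_unit)//.
  by rewrite le_eqVlt; apply/orP; left; apply/eqP; ring.
exists g; apply: (fp_ext1 xi1_unit) => h w ow; rewrite (dot_V1 xi1_unit)//.
have [->|w0] := eqVneq w [::]; first by rewrite dotC gP -dotC mulr1.
have [c [k [c0 oc oc' ->]]] := V11_decomposition xi1_unit flipS ow w0.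
by rewrite commuting_orth_V11//; case: w w0 {ow} => //= *; rewrite mulr0.
Qed.

End Commuting.
End FreeProduct.

(** * Invariant subspaces of tuples *)

Section ScalarMatrix.
Variables (R : realType) (K1 K2 : hilbertType R)
  (M1 : set (K1 -> K1)) (tau1 : (K1 -> K1) -> R[i])
  (M2 : set (K2 -> K2)) (tau2 : (K2 -> K2) -> R[i])
  (vnM1 : von_neumann M1) (tr1 : faithful_normal_trace M1 tau1)
  (vnM2 : von_neumann M2) (tr2 : faithful_normal_trace M2 tau2)
  (E1 : L2 M1 tau1) (E2 : L2 M2 tau2) (F : L2_free_product E1 E2).
Local Notation v1 := (L2_vec E1).
Local Notation v2 := (L2_vec E2).
Local Notation xi1 := (v1 id).
Local Notation xi2 := (v2 id).
Local Notation word := (fp_word F).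
Local Notation V1 := (fp_V1 F).
Local Notation Om := (word [::]).
Local Notation off1 := (reduced_off_left xi1 xi2).
Local Notation off2 := (reduced_off_right xi1 xi2).

Let xi1_unit : dot xi1 xi1 = 1 := L2_xi_norm vnM1 tr1 E1.
Let xi2_unit : dot xi2 xi2 = 1 := L2_xi_norm vnM2 tr2 E2.

Variable Sg : F -> F.
Hypothesis flipS : is_flip Sg.
Local Notation r1 := (right_emb1 (E1 := E1) Sg).
Local Notation r2 := (right_emb2 (E2 := E2) Sg).

Lemma L2_ext (x y : E1) : (forall S, M1 S -> dot x (v1 S) = dot y (v1 S)) -> x = y.
Proof.
move=> xy; apply/subr0_eq/dot_eq0; rewrite dotC; apply: (can_inj (@conjCK _)).
rewrite conjCK rmorph0.
have dD (z : E1) (e : R) : 0 < e -> exists2 y, (v1 @` M1) y & nr (z - y) < e.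
  by move=> e0; have [S MS xS] := L2_dense z e0; exists (v1 S) => //; exists S.
apply: (@linear_eq_dense _ _ _ (fun z => dot z (x - y)) (nr (x - y)) _ _ _ dD).
- by move=> u v; rewrite dotBl.
- by move=> z; rewrite mulrC cauchy_schwarz.
by move=> _ [S MS <-]; rewrite dotC dotBl xy// subrr rmorph0.
Qed.

Lemma emb1_Om a : M1 a -> emb1 F a Om = V1 (v1 a) [::].
Proof.
move=> Ma; rewrite -[Om](V1_xi xi1_unit)// /emb1 fp_rep1_V//; last exact: L2_mul_bound.
by rewrite L2_mul_xi.
Qed.

Lemma right_emb1_Om a : M1 a -> r1 a Om = V1 (v1 a) [::].
Proof.
move=> Ma; rewrite -[Om](V1_xi xi1_unit)// -right_V1_nil /right_emb1 (rho1_V xi1_unit flipS)//.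
  by rewrite (right_mul_xi vnM1 tr1).
exact: (right_mul_bounded vnM1 tr1).
Qed.

Variable Z : K2 -> K2.
Hypotheses (M2Z : M2 Z) (nsZ : ~ exists c : R[i], Z = (fun x => c *: x)).

Definition z0 : R[i] := dot (v2 Z) xi2.
Definition zo : E2 := v2 Z - z0 *: xi2.
Definition zword : seq (E1 + E2) := [:: inr zo].

Lemma zo_centred : dot zo xi2 = 0.
Proof. exact: (centred2 xi2_unit). Qed.

(** As [xi2] separates M2, a vanishing [zo] would make [Z] equal to the scalar [z0]. *)
Lemma zo_neq0 : zo <> 0.
Proof.
move=> /subr0_eq vZ; apply: nsZ; exists z0.
have Mid := vn_id vnM2.
have MZ : M2 ((- z0) *: id + Z) by exact: vn_linear.
have : v2 ((- z0) *: id + Z) = 0 by rewrite L2_vec_linear// vZ scaleNr addNr.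
move=> /(L2_vec_inj vnM2 tr2 MZ) h; apply/funext => x.
have /(congr1 (@^~ x)) := h; rewrite !fctE scaleNr addrC => /subr0_eq.
by [].
Qed.

Lemma zword_off1 : off1 zword.
Proof. by rewrite /reduced_off_left /reduced /= zo_centred eqxx. Qed.

Lemma zword_dot : word_dot zword zword <> 0.
Proof. by rewrite /= mulr1 => /dot_eq0; exact: zo_neq0. Qed.

Lemma red_off2 (x : E1) : off2 [:: inl (x - dot x xi1 *: xi1)].
Proof. by rewrite /reduced_off_right /reduced /= (centred1 xi1_unit) eqxx. Qed.

(** With the trivial first leg [xi1], the last term is zo (x) x for arbitrary, not necessarily
    centred, [x]: left multiplication by [Z] puts [zo] in front of [x]. *)
Lemma emb2_V1 x : emb2 F Z (V1 x [::]) = z0 *: V1 x [::] + V11 F xi1 zword x.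
Proof.
have bZ : bounded_op (L2_mul E2 Z) by exact: L2_mul_bound.
have lZ := bounded_op_lin (fp_rep2_bounded F bZ).
have step w : off2 w -> emb2 F Z (word w) = z0 *: word w + word (inr zo :: w).
  move=> ow; rewrite -{1}(V2_xi xi2_unit F ow) /emb2 fp_rep2_V//.
  by rewrite (L2_mul_xi vnM2).
rewrite {1}/fp_V1 [LHS]lZ -!/(emb2 F Z _) !step ?red_off2//.
rewrite /V11 !(V1_xi xi1_unit) ?zword_off1//; last first.
  by rewrite /reduced_off_left /reduced /= zo_centred (centred1 xi1_unit) eqxx.
rewrite /fp_V1 !scalerDr !scalerA [z0 * _]mulrC -!addrA; congr (_ + _).
by rewrite addrCA.
Qed.

Lemma right_emb2_V1 x : r2 Z (V1 x [::]) = z0 *: V1 x [::] + V1 x zword.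
Proof.
have bZ := right_mul_bounded vnM2 tr2 E2 M2Z.
have lZ := bounded_op_lin (rho2_bounded flipS bZ).
have step w : off2 (rev w) -> r2 Z (word w) = z0 *: word w + word (rcons w (inr zo)).
  move=> ow; have wE : word w = right_V2 F w xi2.
    rewrite (right_V2E xi2_unit flipS)// (V2_xi xi2_unit)// (flip_word flipS) ?revK//.
    by case/andP: ow.
  rewrite {1}wE /right_emb2.
  by rewrite (rho2_V xi2_unit flipS)// (right_mul_xi vnM2 tr2).
rewrite {1}/fp_V1 [LHS]lZ -!/(r2 Z _) !step ?red_off2//.
rewrite /fp_V1 !scalerDr !scalerA [z0 * _]mulrC -!addrA; congr (_ + _).
by rewrite addrCA.
Qed.

Section Matrix.
Variables (I : finType) (P : I -> I -> F -> F).
Variable N : set (K1 -> K1).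
Hypotheses (vnN : von_neumann N) (sNM : N `<=` M1) (dN : diffuse N).
Hypothesis P_adjoint : forall i j, adjoint (P i j) (P j i).
Hypothesis P_emb1 : forall i j e x, proj_in N e -> P i j (emb1 F e x) = emb1 F e (P i j x).
Hypothesis P_right1 : forall i j a x, M1 a -> P i j (r1 a x) = r1 a (P i j x).
Hypothesis P_right2 : forall i j a x, M2 a -> P i j (r2 a x) = r2 a (P i j x).
Hypothesis P_idem : forall i j x, \sum_k P i k (P k j x) = P i j x.
Hypothesis P_Z : forall i j,
  \sum_k P i k (emb2 F Z (P k j Om)) = emb2 F Z (P i j Om).

(* With [P i j Om = X i j] in L^2(M1), P Z P = Z P yields
   sum_k P i k (zo (x) X k j) = zo (x) X i j; pairing it with zo (x) b and with b (x) zo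
   gives [rowX] and [XE]. *)
Lemma matrix_scalar : exists c : I -> I -> R[i], forall i j x, P i j x = c i j *: x.
Proof.
have lP i j : linear (P i j) := adjoint_linear (P_adjoint i j).
have on : off1 [::] by [].
have oz := zword_off1; have z0N : zword != [::] by [].
have ozr : off1 (rev zword) by [].
have Mid := vn_id vnM1.
(* The entry commutes with left and right multiplication by [e], which agree on Omega; so P_ij Omega
   satisfies the hypothesis of [commuting_vec]. *)
have XP ij : exists x, P ij.1 ij.2 Om = V1 x [::].
  apply: (commuting_vec vnM1 tr1 flipS vnN sNM dN) => e pe.
  have Me := sNM pe.1.
  by rewrite -P_emb1// -(P_right1 _ _ _ Me) emb1_Om// right_emb1_Om.
have [X0 X0P] := choice XP.
pose X i j := X0 (i, j); have {}XP i j : P i j Om = V1 (X i j) [::] := X0P (i, j).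
have OmE : Om = V1 xi1 [::] by rewrite (V1_xi xi1_unit).
have PV b i j : M1 b -> P i j (V1 (v1 b) [::]) = V1 (right_mul E1 b (X i j)) [::].
  move=> Mb; have bb := right_mul_bounded vnM1 tr1 E1 Mb.
  rewrite -right_emb1_Om// P_right1// XP -!right_V1_nil.
  by rewrite /right_emb1 (rho1_V xi1_unit flipS).
(* Right multiplication by [Z] appends [zo], up to a multiple [z0] of the vector, and [P i j]
   commutes with it. *)
have Pz h h' i j : P i j (V1 h [::]) = V1 h' [::] -> P i j (V1 h zword) = V1 h' zword.
  move=> Ph; have E k : V1 k zword = r2 Z (V1 k [::]) - z0 *: V1 k [::].
    by rewrite right_emb2_V1 addrAC subrr add0r.
  rewrite !E (linear_mapB _ _ (lP i j)) (linear_mapZ _ _ (lP i j)) P_right2//.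
  by rewrite Ph.
(* The tensor zo (x) b is the right multiple by [b] of xi1 (x) zo, which [Pz] sends to X_ij (x)
   zo. *)
have Pxz i j b : M1 b -> P i j (V11 F xi1 zword (v1 b)) = V11 F (X i j) zword (v1 b).
  move=> Mb; have bb := right_mul_bounded vnM1 tr1 E1 Mb.
  rewrite -(right_mul_xi vnM1 tr1 E1 Mb) -!(rho1_V11 xi1_unit flipS)//.
  rewrite -/(right_emb1 _ _) P_right1//; congr (r1 b _).
  rewrite !(V11_xi xi1_unit flipS)//; apply: Pz.
  by rewrite -OmE XP.
have test i j y : \sum_k dot (V11 F xi1 zword (X k j)) (P k i y) =
    dot (V11 F xi1 zword (X i j)) y.
  (* The [z0] terms of P Z P = Z P agree by idempotence and cancel. *)
  have : \sum_k P i k (V11 F xi1 zword (X k j)) = V11 F xi1 zword (X i j).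
    have := P_Z i j; rewrite XP emb2_V1.
    under eq_bigr do rewrite XP emb2_V1 (lP i _) -XP.
    rewrite big_split/= -scaler_sumr P_idem XP.
    by move/addrI.
  move=> <-; rewrite dot_suml; apply: eq_bigr => k _.
  by rewrite P_adjoint.
have Xherm i j : dot xi1 (X i j) = dot (X j i) xi1.
  have := P_adjoint j i Om Om; rewrite !XP OmE !(dot_V1 xi1_unit)//= !mulr1.
  by [].
have nz := zword_dot.
(* With x_ik the coefficient of X_ik along [xi1], this is sum_k x_ik X_kj = X_ij. Test vector: zo
   (x) b; the common factor |zo|^2 cancels. *)
have rowX i j : \sum_k dot (X i k) xi1 *: X k j = X i j.
  apply: L2_ext => b Mb; have := test i j (V11 F xi1 zword (v1 b)).
  under eq_bigr do rewrite Pxz// (dot_V11 xi1_unit)// Xherm.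
  rewrite (dot_V11 xi1_unit)// xi1_unit mul1r -mulr_suml => /(mulIf (introN eqP nz)) <-.
  by rewrite dot_suml; apply: eq_bigr => k _; rewrite dotZl.
(* The test vector b' (x) zo gives sum_k x_ik X_kj = x_ij xi1, and [rowX] identifies the left side
   with X_ij. The adjoint [b'] enters through <xi1, x b'> = <b, x>. *)
have XE i j : X i j = dot (X i j) xi1 *: xi1.
  rewrite -[LHS]rowX; apply: L2_ext => b Mb; have [b' Mb' bb] := vn_adj vnM1 Mb.
  have := test j i (V1 (v1 b') zword).
  have Rb x : dot xi1 (right_mul E1 b' x) = dot (v1 b) x.
    by rewrite -(right_mul_adjoint vnM1 tr1 Mb Mb' bb) (right_mul_xi vnM1 tr1).
  under eq_bigr => k _ do rewrite (Pz _ _ _ _ (PV _ k j Mb')) -!(V11_xi xi1_unit flipS)//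
    (dot_V11 xi1_unit)// Rb.
  rewrite -[V1 _ zword](V11_xi xi1_unit flipS)// (dot_V11 xi1_unit)//.
  have -> : dot xi1 (v1 b') = dot (v1 b) xi1.
    by rewrite -(right_mul_xi vnM1 tr1 E1 Mb') Rb.
  rewrite -mulr_suml => /(mulIf (introN eqP nz)) /(congr1 Num.conj).
  rewrite rmorph_sum rmorphM/= -!dotC Xherm mulrC dotZl => <-.
  rewrite dot_suml; apply: eq_bigr => k _.
  by rewrite rmorphM/= -!dotC dotZl Xherm mulrC.
exists (fun i j => dot (X i j) xi1) => i j.
set c := dot (X i j) xi1.
(* The equation P_ij x = c x is stated through the adjoint entry, which exhibits [W] as an
   intersection of orthogonal complements, hence closed. *)
pose W := [set x | forall y, dot x (P j i y - c^* *: y) = 0].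
suff WT : W = setT.
  move=> x; apply: dot_inj => y; apply/subr0_eq.
  have : W x by rewrite WT.
  by move=> /(_ y); rewrite dotBr dotZr conjCK -P_adjoint dotZl.
have shift (T T' : F -> F) : adjoint T T' -> (forall i j x, P i j (T' x) = T' (P i j x)) ->
    forall x, W x -> W (T x).
  move=> TT cT x Wx y; rewrite TT; have lT' := adjoint_linear (adjoint_sym TT).
  by rewrite (linear_mapB _ _ lT') (linear_mapZ _ _ lT') -cT Wx.
apply: (right_emb_cyclic vnM1 tr1 vnM2 tr2 flipS).
- by apply: closed_subspace_all => y; exact: closed_subspace_orth.
- move=> y; rewrite dotBr dotZr conjCK -P_adjoint XP XE -/c.
  have -> : V1 (c *: xi1) [::] = c *: Om.
    by rewrite /fp_V1 dotZl xi1_unit mulr1 subrr word_inl0// addr0.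
  by rewrite dotZl subrr.
- move=> a x Ma; have [a' Ma' aa] := vn_adj vnM1 Ma.
  apply: shift; first exact: (right_emb1_adjoint vnM1 tr1 flipS Ma Ma' aa).
  by move=> i' j' y; exact: P_right1.
- move=> a x Ma; have [a' Ma' aa] := vn_adj vnM2 Ma.
  apply: shift; first exact: (right_emb2_adjoint vnM2 tr2 flipS Ma Ma' aa).
  by move=> i' j' y; exact: P_right2.
Qed.

End Matrix.

End ScalarMatrix.

(** * Matrix entries of the projection onto a subspace of tuples *)

Section TupleProjection.
Variables (R : realType) (H : hilbertType R) (n : nat) (W : set ('I_n -> H)).
Hypothesis WL : forall (a : R[i]) f g, W f -> W g -> W (fun i => a *: f i + g i).
Variable Pr : ('I_n -> H) -> ('I_n -> H).
Hypothesis PrW : forall f, W (Pr f).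
Hypothesis PrP : forall f h, W h -> tuple_dot (fun i => f i - Pr f i) h = 0.
Implicit Types f g : 'I_n -> H.

Lemma tuple_dotBl f g h : tuple_dot (fun i => f i - g i) h = tuple_dot f h - tuple_dot g h.
Proof. by rewrite /tuple_dot -sumrB; apply: eq_bigr => i _; rewrite dotBl. Qed.

Lemma tuple_dotC f g : tuple_dot f g = (tuple_dot g f)^*.
Proof. by rewrite /tuple_dot rmorph_sum; apply: eq_bigr => i _; rewrite dotC. Qed.

Lemma tuple_proj_uniq f g : W g -> (forall h, W h -> tuple_dot (fun i => f i - g i) h = 0) ->
  Pr f = g.
Proof.
move=> Wg gP; pose d i := Pr f i - g i.
have Wd : W d.
  have := WL (-1) Wg (PrW f); congr W; apply/funext => i.
  by rewrite scaleN1r addrC.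
have : tuple_dot d d = 0.
  have := gP _ Wd; have := PrP f Wd; by rewrite !tuple_dotBl => /subr0_eq ->.
rewrite /tuple_dot; under eq_bigr do rewrite dotx.
rewrite -rmorph_sum/= -(rmorph0 (real_complex R)) => /complexI/eqP.
rewrite psumr_eq0 => [/allP d0|i _]; last exact: sqr_ge0.
apply/funext => i; apply/subr0_eq/nr_eq0/eqP; rewrite -sqrf_eq0.
by apply: d0; rewrite mem_index_enum.
Qed.

Lemma tuple_proj_id f : W f -> Pr f = f.
Proof.
move=> Wf; apply: tuple_proj_uniq => // h _; rewrite /tuple_dot big1// => i _.
by rewrite subrr dot0l.
Qed.

Lemma tuple_proj_adjoint f g : tuple_dot (Pr f) g = tuple_dot f (Pr g).
Proof.
have := PrP f (PrW g); rewrite tuple_dotBl => /subr0_eq ->.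
have := PrP g (PrW f); rewrite tuple_dotBl => /subr0_eq h.
by rewrite tuple_dotC h -tuple_dotC.
Qed.

(** Invariance under [T] and its adjoint means that [T] preserves both [W] and its orthogonal
    complement. *)
Lemma tuple_proj_comm (T T' : H -> H) : adjoint T T' ->
  (forall f, W f -> W (T \o f)) -> (forall f, W f -> W (T' \o f)) ->
  forall f, Pr (T \o f) = T \o Pr f.
Proof.
move=> TT WT WT' f; have lT := adjoint_linear TT.
apply: tuple_proj_uniq => [|h Wh]; first exact/WT/PrW.
rewrite -(PrP f (WT' _ Wh)) /tuple_dot; apply: eq_bigr => i _ /=.
by rewrite -(linear_mapB _ _ lT) TT.
Qed.

Definition tuple_delta (j : 'I_n) (x : H) : 'I_n -> H := fun k => if k == j then x else 0.
Definition proj_entry (i j : 'I_n) (x : H) : H := Pr (tuple_delta j x) i.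

Lemma tuple_dot_delta f i y : tuple_dot f (tuple_delta i y) = dot (f i) y.
Proof.
rewrite /tuple_dot (bigD1 i)//= /tuple_delta eqxx big1 ?addr0// => k /negPf ->.
exact: dot0r.
Qed.

Lemma proj_entry_adjoint i j : adjoint (proj_entry i j) (proj_entry j i).
Proof.
move=> x y; rewrite /proj_entry -tuple_dot_delta tuple_proj_adjoint tuple_dotC.
by rewrite tuple_dot_delta -dotC.
Qed.

Lemma proj_entryE f i : Pr f i = \sum_j proj_entry i j (f j).
Proof.
apply: dot_inj => y; rewrite dot_suml -tuple_dot_delta tuple_proj_adjoint.
by apply: eq_bigr => j _; rewrite proj_entry_adjoint.
Qed.

Lemma proj_entry_comm (T T' : H -> H) : adjoint T T' ->
  (forall f, W f -> W (T \o f)) -> (forall f, W f -> W (T' \o f)) ->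
  forall i j x, proj_entry i j (T x) = T (proj_entry i j x).
Proof.
move=> TT WT WT' i j x; rewrite /proj_entry.
have -> : tuple_delta j (T x) = T \o tuple_delta j x.
  apply/funext => k; rewrite /tuple_delta /=; case: eqP => // _.
  by rewrite (linear_map0 (adjoint_linear TT)).
by rewrite (tuple_proj_comm TT).
Qed.

(** The relation P T P = T P in matrix entries; [T = id] gives the idempotence of P. *)
Lemma proj_entry_invariant (T : H -> H) : (forall f, W f -> W (T \o f)) ->
  forall i j x, \sum_k proj_entry i k (T (proj_entry k j x)) = T (proj_entry i j x).
Proof.
move=> WT i j x; rewrite -(proj_entryE (T \o Pr (tuple_delta j x))).
by rewrite tuple_proj_id//; exact/WT/PrW.
Qed.

End TupleProjection.

Section Density.
Variables (R : realType) (K1 K2 : hilbertType R)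
  (M1 : set (K1 -> K1)) (tau1 : (K1 -> K1) -> R[i])
  (M2 : set (K2 -> K2)) (tau2 : (K2 -> K2) -> R[i])
  (vnM1 : von_neumann M1) (tr1 : faithful_normal_trace M1 tau1)
  (vnM2 : von_neumann M2) (tr2 : faithful_normal_trace M2 tau2)
  (E1 : L2 M1 tau1) (E2 : L2 M2 tau2) (F : L2_free_product E1 E2).
Variable Sg : F -> F.
Hypothesis flipS : is_flip Sg.
Variable Z : K2 -> K2.
Hypotheses (M2Z : M2 Z) (nsZ : ~ exists c : R[i], Z = (fun x => c *: x)).
Variable N : set (K1 -> K1).
Hypotheses (vnN : von_neumann N) (sNM : N `<=` M1) (dN : diffuse N).

(** [W] is the closure of the orbit of the tuple [x], and contains [x] since [A] contains the
    identity. Its projection P has scalar entries, so it commutes with [B] applied to each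
    coordinate: B x = B (P x) = P (B x) lies in [W]. *)
Theorem free_product_density (A : set (F -> F)) : subalgebra A -> A id ->
  A (emb2 F Z) -> (forall T, N T -> A (emb1 F T)) ->
  (forall a, M1 a -> A (right_emb1 Sg a)) -> (forall a, M2 a -> A (right_emb2 Sg a)) ->
  forall (B : F -> F), linear B -> forall n (x : 'I_n -> F) (e : R), 0 < e ->
  exists2 T, A T & forall i, nr (B (x i) - T (x i)) < e.
Proof.
move=> [Ab A0 AL AM] A1 AZ AN AR1 AR2 B lB n x.
pose W := [set y : 'I_n -> F | forall e : R, 0 < e ->
  exists2 T, A T & forall i, nr (y i - T (x i)) < e].
suff : W (B \o x) by [].
have WL (a : R[i]) f g : W f -> W g -> W (fun i => a *: f i + g i).
  move=> Wf Wg e e0; have a1 : 0 < nr a + 1 by rewrite ltr_wpDl ?nr_ge0.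
  have [|S AS fS] := Wf (e / 2 / (nr a + 1)); first by rewrite !divr_gt0.
  have [|T AT gT] := Wg (e / 2); first by rewrite divr_gt0.
  exists (a *: S + T); first exact: AL.
  move=> i; rewrite !fctE opprD addrACA -scalerBr (le_lt_trans (nrD _ _))// nrZ.
  have := fS i; rewrite ltr_pdivlMr// => fSi; have gTi := gT i.
  by have := nr_ge0 (f i - S (x i)); nra.
have W0 : W (fun=> 0).
  by move=> e e0; exists 0 => // i; rewrite subrr nr0.
have Wc f : (forall e : R, 0 < e -> exists2 g, W g & forall i, nr (f i - g i) < e) -> W f.
  move=> fP e e0; have [|g Wg fg] := fP (e / 2); first by rewrite divr_gt0.
  have [|T AT gT] := Wg (e / 2); first by rewrite divr_gt0.
  exists T => // i; rewrite -(subrKA (g i)) (le_lt_trans (nrD _ _))//.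
  by have := fg i; have := gT i; lra.
have Winv S f : A S -> W f -> W (S \o f).
  move=> AS Wf e e0; have bS := Ab _ AS; have [C C0 bC] := bounded_op_bound bS.
  have [|T AT fT] := Wf (e / (C + 1)); first by rewrite divr_gt0// ltr_wpDl.
  exists (S \o T); first exact: AM.
  move=> i /=; rewrite -(linear_mapB _ _ (bounded_op_lin bS)) (le_lt_trans (bC _))//.
  have := fT i; rewrite ltr_pdivlMr ?ltr_wpDl// => h.
  by have := nr_ge0 (f i - T (x i)); lra.
have Wx : W x by move=> e e0; exists id => // i; rewrite subrr nr0.
have PrX f : exists g, W g /\ forall h, W h -> tuple_dot (fun i => f i - g i) h = 0.
  by have [g Wg gP] := projection_exists W0 WL Wc f; exists g.
have [Pr PrP] := choice PrX; have PrW f := (PrP f).1; have {}PrP f := (PrP f).2.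
have comm (T T' : F -> F) (i j : 'I_n) y : A T -> A T' -> adjoint T T' ->
    proj_entry Pr i j (T y) = T (proj_entry Pr i j y).
  by move=> AT AT' TT; apply: (proj_entry_comm WL PrW PrP TT) => f; exact: Winv.
have [||||||c cP] := @matrix_scalar _ _ _ _ _ _ _ vnM1 tr1 vnM2 tr2 E1 E2 F Sg flipS
  Z M2Z nsZ _ (proj_entry Pr) N vnN sNM dN.
- exact: (proj_entry_adjoint PrW PrP).
- move=> i j f y [Nf pf]; apply: (comm _ (emb1 F f)); [exact: AN|exact: AN|].
  by apply: (emb1_adjoint vnM1 tr1); [exact: sNM|exact: sNM|exact: proj_adj].
- move=> i j a y Ma; have [a' Ma' aa] := vn_adj vnM1 Ma.
  apply: comm; [exact: AR1 Ma|exact: AR1 Ma'|exact: (right_emb1_adjoint vnM1 tr1)].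
- move=> i j a y Ma; have [a' Ma' aa] := vn_adj vnM2 Ma.
  apply: comm; [exact: AR2 Ma|exact: AR2 Ma'|exact: (right_emb2_adjoint vnM2 tr2)].
- by move=> i j y; apply: (proj_entry_invariant WL PrW PrP (T := id)).
- by move=> i j; apply: (proj_entry_invariant WL PrW PrP) => f; exact: Winv.
have xE i : x i = \sum_j c i j *: x j.
  rewrite -{1}(tuple_proj_id WL PrW PrP Wx) (proj_entryE PrW PrP).
  by apply: eq_bigr => j _; rewrite cP.
suff <- : Pr (B \o x) = B \o x by exact: PrW.
apply/funext => i; rewrite (proj_entryE PrW PrP) /= [in RHS]xE.
have -> : B (\sum_j c i j *: x j) = \sum_j B (c i j *: x j).
  by elim/big_rec2: _ => [|j y z _ <-]; [exact: linear_map0|exact: linear_mapD].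
by apply: eq_bigr => j _; rewrite cP (linear_mapZ _ _ lB).
Qed.

End Density.

(** * Strong density, and transfer to L^2(M, tau) *)

Lemma smallest_subalgebra (R : realType) (H : hilbertType R) (G : set (H -> H)) :
  G `<=` @bounded_op R H -> subalgebra (smallest (@subalgebra R H) G).
Proof.
move=> Gb.
have bA : subalgebra (@bounded_op R H).
  split=> //; [exact: bounded_op0|by move=> a S T; exact: bounded_op_linear|].
  by move=> S T; exact: bounded_op_comp.
split.
- by move=> T; apply.
- by move=> B [[_ B0 _ _] _].
- move=> a S T AS AT B [sB GB]; have [_ _ BL _] := sB.
  by apply: BL; [exact: AS|exact: AT].
move=> S T AS AT B [sB GB]; have [_ _ _ BM] := sB.
by apply: BM; [exact: AS|exact: AT].
Qed.

Lemma strongly_dense_finite (R : realType) (H : hilbertType R) (A : set (H -> H)) (B : H -> H) :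
  (forall n (x : 'I_n -> H) (e : R), 0 < e ->
     exists2 T, A T & forall i, nr (B (x i) - T (x i)) < e) ->
  closure (A : set {ptws H -> H}) B.
Proof.
move=> AB; rewrite closureEcvg.
(* Finite lists of points with a tolerance index the base of a filter on [A] that converges
   pointwise to [B]. *)
pose D (p : seq H * R) : set (H -> H) :=
  [set T | A T /\ forall x, x \in p.1 -> nr (B x - T x) < p.2].
pose Fl := filter_from [set p : seq H * R | 0 < p.2] D.
have pFl : ProperFilter Fl.
  apply: filter_from_proper.
    apply: filter_from_filter; first by exists ([::], 1) => /=.
    move=> [s e] [s' e'] /= e0 e'0; exists (s ++ s', Num.min e e') => /=.
      by rewrite lt_min e0 e'0.
    move=> T [AT TP]; split; split=> // x xs.
      have : x \in s ++ s' by rewrite mem_cat xs.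
      by move=> /TP/=; rewrite lt_min => /andP[].
    have : x \in s ++ s' by rewrite mem_cat xs orbT.
    by move=> /TP/=; rewrite lt_min => /andP[].
  move=> [s e] /= e0; have [T AT TP] := AB _ (tnth (in_tuple s)) _ e0.
  exists T; split=> //= x xs; have /tnthP[i ->] : x \in in_tuple s by [].
  exact: TP.
exists Fl => //; split.
  apply/pointwise_cvgP => x X /nbhs_nrP[e e0 eX].
  exists ([:: x], e) => // T [_ TP]; apply/eX/TP.
  by rewrite inE.
by move=> X AX; exists ([::], 1) => [|T]; [exact: ltr01|move=> [AT _]; exact: AX].
Qed.

Theorem corollary4p2 (R : realType) (K1 K2 : hilbertType R)
  (M1 : set (K1 -> K1)) (tau1 : (K1 -> K1) -> R[i])
  (M2 : set (K2 -> K2)) (tau2 : (K2 -> K2) -> R[i])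
  (vnM1 : von_neumann M1) (tr1 : faithful_normal_trace M1 tau1)
  (vnM2 : von_neumann M2) (tr2 : faithful_normal_trace M2 tau2)
  (E1 : L2 M1 tau1) (E2 : L2 M2 tau2) (F : L2_free_product E1 E2)
  (E : L2 (reduced_free_product F) (vacuum_trace F))
  (N : set (K1 -> K1)) (vnN : von_neumann N) (sNM1 : N `<=` M1)
  (dN : diffuse N)
  (Z : K2 -> K2) (M2Z : M2 Z)
  (nsZ : ~ exists c : R[i], Z = (fun x => c *: x)) :
  let A : set (E -> E) :=
    smallest (@subalgebra R E)
      ([set L2_mul E (emb2 F Z)]
       `|` [set L2_mul E (emb1 F T) | T in N]
       `|` commutant (L2_mul E @` reduced_free_product F)) in
  transitive_algebra A /\ strongly_dense A.
Proof.
move=> A; set M := reduced_free_product F in E A *.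
pose G : set (F -> F) := emb1 F @` M1 `|` emb2 F @` M2.
have Gb : G `<=` @bounded_op R F.
  by move=> _ [|] [S MS <-]; [exact: emb1_bounded|exact: emb2_bounded].
have [[Mb _ ML MM] Mid] : subalgebra M /\ M id.
  by apply: commutant_subalgebra; exact: commutant_bounded.
have GM : G `<=` M by exact: sub_bicommutant.
have ME1 S : M1 S -> M (emb1 F S) by move=> MS; apply: GM; left; exists S.
have ME2 S : M2 S -> M (emb2 F S) by move=> MS; apply: GM; right; exists S.
have LMb T : M T -> bounded_op (L2_mul E T) by exact: L2_mul_bounded.
pose Om := fp_word F [::].
(* The graph of the unitary that sends the vector of [S] to [S Om]; it is isometric because the
   trace is the vacuum state. *)
pose rel (x : E) (y : F) := exists S, [/\ M S, x = L2_vec E S & y = S Om].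
have relL a x x' y y' : rel x y -> rel x' y' -> rel (a *: x + x') (a *: y + y').
  move=> [S [MS -> ->]] [T [MT -> ->]]; exists (a *: S + T).
  by split; [exact: ML|rewrite L2_vec_linear|].
have relN x y : rel x y -> nr y = nr x.
  move=> [S [MS -> ->]]; have [S' SS] := adjoint_exists (Mb _ MS).
  apply/eqP; rewrite -(@eqrXn2 _ 2)// ?nr_ge0//; apply/eqP/complexI.
  by rewrite -!dotx (L2_vec_dot E MS MS SS) /vacuum_trace /= (adjoint_sym SS).
have relD1 x (e : R) : 0 < e -> exists x' y', rel x' y' /\ nr (x - x') < e.
  move=> e0; have [_ [S MS <-] xS] := dense_nr (@L2_vec_dense _ _ _ _ E) x e0.
  by exists (L2_vec E S), (S Om); split=> //; exists S.
pose D := [set S Om | S in M].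
(* Density of the range is the cyclicity of Omega for [M]. *)
have relD2 y (e : R) : 0 < e -> exists x' y', rel x' y' /\ nr (y - y') < e.
  pose W := [set x | forall e : R, 0 < e -> exists2 y, D y & nr (x - y) < e].
  have WD S x : M S -> W x -> W (S x).
    move=> MS Wx e' e'0; have bS := Mb _ MS; have [C C0 bC] := bounded_op_bound bS.
    have [|_ [T MT <-]] := Wx (e' / (C + 1)); first by rewrite divr_gt0// ltr_wpDl.
    rewrite ltr_pdivlMr ?ltr_wpDl// => xT.
    exists (S (T Om)); first by exists (S \o T) => //; exact: MM.
    rewrite -(linear_mapB _ _ (bounded_op_lin bS)) (le_lt_trans (bC _))//.
    by have := nr_ge0 (x - T Om); lra.
  suff WT : W = setT.
    have : W y by rewrite WT.
    by move=> h /h[_ [S MS <-] yS]; exists (L2_vec E S), (S Om); split=> //; exists S.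
  apply: (emb_cyclic vnM1 tr1 vnM2 tr2).
  - apply: closed_subspace_closure.
      exists (0 : F -> F) => //.
      have := ML (-1) _ _ Mid Mid; congr M; rewrite scaleN1r; exact: addNr.
    by move=> a _ _ [S MS <-] [T MT <-]; exists (a *: S + T) => //; exact: ML.
  - by move=> e' e'0; exists Om; [exists id|rewrite subrr nr0].
  - by move=> S x MS; apply: WD; exact: ME1.
  - by move=> S x MS; apply: WD; exact: ME2.
have [U [U' [lU lU' UK U'K [nU nU' UG]]]] := unitary_relation relL relN relD1 relD2.
have conj_bounded (T : F -> F) : bounded_op T -> bounded_op (U' \o T \o U).
  move=> /bounded_opP[lT [C C0 bC]]; apply/bounded_opP; split.
    by move=> a x y /=; rewrite lU lT lU'.
  by exists C => // x /=; rewrite nU' -(nU x).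
(* [U] intertwines left multiplication with the given action of [M] on [F]: both turn [S] into
   [T \o S]. *)
have LE T : M T -> L2_mul E T = U' \o T \o U.
  move=> MT; apply: (@eq_dense _ _ _ _ (L2_vec E @` M)).
  - exact: LMb.
  - exact/conj_bounded/Mb.
  - by move=> x e e0; exact: (dense_nr (@L2_vec_dense _ _ _ _ E)).
  move=> _ [S MS <-]; rewrite L2_mul_vec//= (UG _ (S Om)); last by exists S.
  rewrite -[LHS]UK (UG _ ((T \o S) Om))//.
  by exists (T \o S); split=> //; exact: MM.
have [Sg flipS] := flip_exists F.
(* [M] is the bicommutant of [G], so commuting with the generators suffices to commute with [M];
   conjugation by [U] then lands in the commutant of the left multiplications. *)
have commE (T : F -> F) : commutant G T -> A (U' \o T \o U).
  move=> cT B [_ GB]; apply: GB; right; split; first exact/conj_bounded/cT.1.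
  move=> _ [S MS <-]; rewrite LE//; apply/funext => x /=; rewrite !U'K.
  by have /(congr1 (@^~ (U x)))/= -> := MS.2 _ cT.
have Agen : [set L2_mul E (emb2 F Z)] `|` [set L2_mul E (emb1 F T) | T in N]
       `|` commutant (L2_mul E @` M) `<=` @bounded_op R E.
  move=> T [[->|[S NS <-]]|[]//]; first exact/LMb/ME2.
  by apply/LMb/ME1/sNM1.
have sA : subalgebra A by exact: smallest_subalgebra.
have Aid : A id.
  move=> B [_ GB]; apply: GB; right.
  apply: (commutant_subalgebra _).2 => _ [S MS <-]; exact: LMb.
have dense (B : E -> E) n (x : 'I_n -> E) (e : R) : linear B -> 0 < e ->
    exists2 T, A T & forall i, nr (B (x i) - T (x i)) < e.
  move=> lB e0; have [Ab A0 AL AM] := sA.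
  (* The density theorem is used on [F], for the pull-back of [A] along [U] and the conjugate of
     [B]; [U'] is isometric and carries the estimate back. *)
  have [|||||||T [bT AT] TP] := @free_product_density _ _ _ _ _ _ _ vnM1 tr1 vnM2 tr2 E1 E2 F
    Sg flipS Z M2Z nsZ N vnN sNM1 dN
    [set T | bounded_op T /\ A (U' \o T \o U)] _ _ _ _ _ _
    (U \o B \o U') _ n (U \o x) e e0.
  - split=> [T []//||a S T [bS AS] [bT AT]|S T [bS AS] [bT AT]].
    + split; first exact: bounded_op0.
      by move: A0; congr A; apply/funext => y /=; rewrite (linear_map0 lU').
    + split; first exact: bounded_op_linear.
      have := AL a _ _ AS AT; congr A; apply/funext => y.
      by rewrite /= !fctE lU'.
    split; first exact: bounded_op_comp.
    have := AM _ _ AS AT; congr A; apply/funext => y /=.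
    by rewrite U'K.
  - split; first exact: bounded_op_id.
    by move: Aid; congr A; apply/funext => y /=; rewrite UK.
  - split; first exact: emb2_bounded.
    by rewrite -LE; [move=> B' [_ GB']; apply: GB'; left; left|exact: ME2].
  - move=> S NS; have MS := sNM1 _ NS; split; first exact: emb1_bounded.
    by rewrite -LE; [move=> B' [_ GB']; apply: GB'; left; right; exists S|exact: ME1].
  - move=> a Ma; have ba := right_emb1_bounded vnM1 tr1 flipS Ma.
    split=> //; apply: commE; split=> // _ [|] [S MS <-].
      by rewrite (emb1_right_emb1 vnM1 tr1 flipS).
    by rewrite (emb2_right_emb1 vnM1 tr1 vnM2 tr2 flipS).
  - move=> a Ma; have ba := right_emb2_bounded vnM2 tr2 flipS Ma.
    split=> //; apply: commE; split=> // _ [|] [S MS <-].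
      by rewrite (emb1_right_emb2 vnM1 tr1 vnM2 tr2 flipS).
    by rewrite (emb2_right_emb2 vnM2 tr2 flipS).
  - by move=> a y z /=; rewrite lU' lB lU.
  exists (U' \o T \o U) => // i.
  have := TP i; rewrite -nU' (linear_mapB _ _ lU') /= !UK.
  by [].
split; last first.
  split; first by case: sA.
  move=> B [lB _]; apply: strongly_dense_finite => n x e; exact: dense.
split=> // W [/closed_nrP cW W0 WL] iW.
have [[x [Wx x0]]|no] := pselect (exists x, W x /\ x <> 0); [right|left].
  apply/seteqP; split=> // y _; apply: cW => e e0.
  have xx : dot x x != 0 by apply/eqP => /dot_eq0.
  (* This rank-one map sends [x] to [y], so an element of [A] that approximates it at [x] gives a
     vector of [W] near [y]. *)
  have [||T AT TP] := dense (fun z => (dot z x / dot x x) *: y) 1%N (fun=> x) e.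
  - by move=> a u v; rewrite dotDl dotZl mulrDl scalerDl -mulrA scalerA.
  - by [].
  exists (T x); first by apply: (iW T AT); exists x.
  by have := TP ord0; rewrite divff// scale1r.
apply/seteqP; split=> [x Wx|x -> //].
by apply: contrapT => x0; apply: no; exists x.
Qed.
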